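(* Assume (A2), (B1), (B2), and let $x^\star(b_n)$ be any measurable choice of an optimal solution of $(\mathrm{P}_{b_n})$. Assume that for every non-empty $\mathcal{K}\subseteq[N]$ the random vector $(\alpha_n^{\mathcal K},G_n)$ converges in distribution on $\Delta_{|\mathcal K|}\times\mathbb{R}^m$ to some $(\alpha^{\mathcal K},G)$. Then $$r_n\big(x^\star(b_n)-x^\star(b)\big)\xrightarrow{D} M(G^{m_0}):=\sum_{\emptyset\ne\mathcal K\subseteq[K]}\mathbb{1}\Big\{G^{m_0}\in H_{\mathcal K}\setminus\bigcup_{k\in[K]\setminus\mathcal K}H_k\Big\}\,\alpha^{\mathcal K}\otimes x(I_{\mathcal K},G)\in\mathbb{R}^d,$$ where $H_1,\dots,H_K\subseteq\mathbb{R}^{m_0}$ are the closed convex cones defined below, each being an intersection of $m-|\{i:x^\star_i(b)>0\}|$ half-spaces through the origin. In particular, if $x^\star(b)$ is nondegenerate, then $K=1$ and $r_n(x^\star(b_n)-x^\star(b))\xrightarrow{D} x(I_1,G)$, which is a linear function of $G$ (Gaussian if $G$ is Gaussian).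
   Context: Setting: $A\in\mathbb{R}^{m\times d}$ of full rank $m\le d$, $b\in\mathbb{R}^m$, $c\in\mathbb{R}^d$. $(\mathrm{P}_\beta)$: $\min c^Tx$ s.t. $Ax=\beta,x\ge0$; $(\mathrm{D}_\beta)$: $\max\beta^T\lambda$ s.t. $A^T\lambda\le c$. A basis is $I\subseteq[d]$ with $|I|=m$, $A_I$ invertible; for $v\in\mathbb{R}^m$, $x(I,v)\in\mathbb{R}^d$ has coordinates $(A_I)^{-1}v$ on $I$ (in increasing order of indices) and $0$ elsewhere (linear in $v$); $\lambda(I)=(A_I)^{-T}c_I$; $I$ is dual feasible if $A^T\lambda(I)\le c$. Let $I_1,\dots,I_N$ enumerate all dual feasible bases, ordered so that $I_1,\dots,I_K$ are exactly those with $x(I_k,b)\ge 0$. (A2): $(\mathrm{P}_b)$ has a unique optimal solution $x^\star(b)$ (so $x(I_k,b)=x^\star(b)$ for $k\le K$). A basic solution is nondegenerate if it has $m$ nonzero coordinates. Stochastic setting: $r_n>0$, $r_n\to\infty$; $m_0\in\{1,\dots,m\}$; random vectors $b_n=(b_n^{m_0},b_{m_0+1},\dots,b_m)\in\mathbb{R}^m$ (only the first $m_0$ coordinates are random). (B1): $G_n:=r_n(b_n-b)\xrightarrow{D}G=(G^{m_0},0_{m-m_0})$ where $G^{m_0}$ is absolutely continuous w.r.t. Lebesgue measure on $\mathbb{R}^{m_0}$. (B2): $\mathbb{P}((\mathrm{P}_{b_n})\text{ has an optimal solution})\to1$. Weights: for non-empty $\mathcal K\subseteq[N]$ let $A_n^{\mathcal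 K}$ be the event $\{x(I_k,b_n)\ge0\iff k\in\mathcal K\}$; on this event $x^\star(b_n)=\sum_{k\in\mathcal K}(\alpha_n^{\mathcal K})_kx(I_k,b_n)$ for a random vector $\alpha_n^{\mathcal K}$ in the unit simplex $\Delta_{|\mathcal K|}=\{\alpha\in\mathbb{R}_+^{|\mathcal K|}:\|\alpha\|_1=1\}$ (defined arbitrarily but measurably off this event). Notation: $\alpha\otimes x(I_{\mathcal K},v):=\sum_{k\in\mathcal K}\alpha_kx(I_k,v)$. Cones: let $\mathrm{Pos}=\{i:x^\star_i(b)>0\}$; for $k\le K$ write $I_k=\{i^k_1<\dots<i^k_m\}$ and $J_k=\{j\in[m]:i^k_j\notin\mathrm{Pos}\}$; $H_k=\{v\in\mathbb{R}^{m_0}:[(A_{I_k})^{-1}(v,0_{m-m_0})]_j\ge0\ \forall j\in J_k\}$, and $H_{\mathcal K}=\bigcap_{k\in\mathcal K}H_k$. *)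

(* Defs.v *)
From HB Require Import structures.
From mathcomp Require Import all_boot all_order all_algebra.
From mathcomp Require Import all_classical all_reals all_analysis.
Set Implicit Arguments. Unset Strict Implicit. Unset Printing Implicit Defensive.
Import Order.TTheory GRing.Theory Num.Theory.
Import numFieldNormedType.Exports.
Local Open Scope classical_set_scope.
Local Open Scope ring_scope.

Section LP.
Variables (R : realType) (m d : nat) (A : 'M[R]_(m, d)) (c : 'cV[R]_d).

Definition cost (x : 'cV[R]_d) : R := \sum_(i < d) c i 0 * x i 0.

Definition feasible (beta : 'cV[R]_m) (x : 'cV[R]_d) : Prop :=
  A *m x = beta /\ forall i, 0 <= x i 0.
Definition optimal (beta : 'cV[R]_m) (x : 'cV[R]_d) : Prop :=
  feasible beta x /\ forall y, feasible beta y -> cost x <= cost y.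
Definition has_optimal (beta : 'cV[R]_m) : Prop := exists x, optimal beta x.

Definition rank_in (I : {set 'I_d}) (i : 'I_d) : nat := #|[set k in I | (k < i)%N]|.
(** selection matrix: column j of S_I is the unit vector of the j-th
    smallest element of I (increasing order) *)
Definition selmx (I : {set 'I_d}) : 'M[R]_(d, m) :=
  \matrix_(i < d, j < m) ((i \in I) && (rank_in I i == j))%:R.
Definition AI (I : {set 'I_d}) : 'M[R]_m := A *m selmx I.
Definition is_basis (I : {set 'I_d}) : Prop := #|I| = m /\ AI I \in unitmx.
Definition xB (I : {set 'I_d}) (v : 'cV[R]_m) : 'cV[R]_d :=
  selmx I *m (invmx (AI I) *m v).
Definition lambdaB (I : {set 'I_d}) : 'cV[R]_m :=
  invmx (AI I)^T *m ((selmx I)^T *m c).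
Definition dual_feasible_basis (I : {set 'I_d}) : Prop :=
  is_basis I /\ forall i, (A^T *m lambdaB I) i 0 <= c i 0.
Definition nonneg_vec (x : 'cV[R]_d) : Prop := forall i, 0 <= x i 0.
Definition nondeg_basic_sol (x : 'cV[R]_d) : Prop := #|[set i | x i 0 != 0]| = m.

Definition Pos (xs : 'cV[R]_d) : {set 'I_d} := [set i | 0 < xs i 0].
Definition Jset (xs : 'cV[R]_d) (I : {set 'I_d}) : {set 'I_m} :=
  [set j : 'I_m | [exists i : 'I_d,
     [&& i \in I, rank_in I i == j & i \notin Pos xs]]].
End LP.

Definition Hcone (R : realType) (m0 m1 d : nat) (A : 'M[R]_(m0 + m1, d))
  (xs : 'cV[R]_d) (I : {set 'I_d}) : set 'cV[R]_m0 :=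
  [set v | forall j, j \in @Jset R (m0 + m1) d xs I ->
     0 <= (invmx (AI A I) *m col_mx v (0 : 'cV[R]_m1)) j 0].

Definition box_vol (R : realType) (k : nat) (a b : 'cV[R]_k) : R :=
  \prod_(i < k) (b i 0 - a i 0).
Definition in_box (R : realType) (k : nat) (a b v : 'cV[R]_k) : Prop :=
  forall i, a i 0 <= v i 0 <= b i 0.
Definition lebesgue_null (R : realType) (k : nat) (S : set 'cV[R]_k) : Prop :=
  forall e : R, 0 < e -> exists a b : nat -> 'cV[R]_k,
    (forall n i, a n i 0 <= b n i 0) /\
    S `<=` \bigcup_n [set v | in_box (a n) (b n) v] /\
    (forall n, \sum_(j < n) box_vol (a j) (b j) <= e).

Definition rand_cV (dT : measure_display) (T : measurableType dT) (R : realType)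
  (k : nat) (X : T -> 'cV[R]_k) : Prop :=
  forall i, measurable_fun setT (fun w => X w i 0).
Definition rand_rV (dT : measure_display) (T : measurableType dT) (R : realType)
  (k : nat) (X : T -> 'rV[R]_k) : Prop :=
  forall i, measurable_fun setT (fun w => X w 0 i).

Definition cvg_dist (R : realType) (V : topologicalType)
  (dT : measure_display) (T : measurableType dT) (P : probability T R)
  (X : nat -> T -> V)
  (dT' : measure_display) (T' : measurableType dT') (P' : probability T' R)
  (Y : T' -> V) : Prop :=
  forall f : V -> R, continuous f -> (exists M : R, forall v, `|f v| <= M) ->
    (fun n => (\int[P]_w (f (X n w))%:E)%E) @ \oo --> (\int[P']_w (f (Y w))%:E)%E.

Definition law_abs_cont (R : realType) (dT : measure_display)
  (T : measurableType dT) (P : probability T R) (k : nat) (Z : T -> 'cV[R]_k) : Prop :=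
  forall S : set 'cV[R]_k, lebesgue_null S -> measurable (Z @^-1` S) ->
    P (Z @^-1` S) = 0%E.

(** the unit simplex, encoded as vectors of R^N supported on KK *)
Definition in_simplex (R : realType) (N : nat) (KK : {set 'I_N}) (a : 'rV[R]_N) : Prop :=
  (forall k, 0 <= a 0 k) /\ (forall k, k \notin KK -> a 0 k = 0) /\
  \sum_(k < N) a 0 k = 1.

Definition otimes (R : realType) (m d N : nat) (A : 'M[R]_(m, d))
  (Ib : 'I_N -> {set 'I_d}) (KK : {set 'I_N}) (a : 'rV[R]_N) (v : 'cV[R]_m) : 'cV[R]_d :=
  \sum_(k in KK) a 0 k *: xB A (Ib k) v.

(* Main.v *)
Require Import Defs.
From HB Require Import structures.
From mathcomp Require Import all_boot all_order all_algebra.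
From mathcomp Require Import all_classical all_reals all_analysis.
From mathcomp Require Import measurable_realfun ring lra.
Set Implicit Arguments.
Unset Strict Implicit.
Unset Printing Implicit Defensive.
Import Order.TTheory GRing.Theory Num.Theory.
Import numFieldNormedType.Exports.
Local Open Scope classical_set_scope.
Local Open Scope ring_scope.

(** The hypotheses give convergence of ([alpha_n^KK], [G_n]) for each [KK] separately, not jointly
    over all [KK], so there is no single convergent vector to which the continuous mapping theorem
    could be applied. This is why every piece of [cvg_dist_piecewise] has its own sequence [Z j]:
    away from the boundaries one piece is active at a time, and only the separate laws matter. The
    pieces are described by continuous gap functions rather than by sets, since convergence in
    distribution is tested on continuous functions. The second obstacle is degeneracy: at a
    degenerate optimal vertex a basis may fail to be dual feasible. Perturbing the right-hand side
    removes degeneracy, and since dual feasibility of a basis does not involve the right-hand side,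
    it survives the return to the original problem. *)

(* With high probability [b_n] is close to [b], and then a basis [I_k] is primal
   feasible at [b_n] iff [k <= K] and [G_n] lies in the cone [H_k]: the positive
   coordinates of [x*(b)] stay positive, and the other ones only depend on [G_n].
   On that event [r_n (x*(b_n) - x*(b))] equals [alpha_n (x) x(I_KK, G_n)], where
   [KK] is the set of cones containing [G_n]; it is nonempty because every
   solvable linear program has a basis that is both primal and dual feasible.
   So the rescaled solution is glued from continuous functions of
   [(alpha_n^KK, G_n)] along hyperplanes that the law of the limit does not
   charge, and the conclusion is a continuous mapping theorem. *)

(** * Basic solutions and optimal bases *)

Lemma rank_in_lt (d : nat) (I : {set 'I_d}) (i : 'I_d) :
  i \in I -> (rank_in I i < #|I|)%N.
Proof.
move=> iI; apply: proper_card; apply/properP; split.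
  by apply/fintype.subsetP => k; rewrite inE => /andP[].
by exists i => //; rewrite inE ltnn andbF.
Qed.

Lemma rank_in_mono (d : nat) (I : {set 'I_d}) (i k : 'I_d) :
  i \in I -> (i < k)%N -> (rank_in I i < rank_in I k)%N.
Proof.
move=> iI ik; apply: proper_card; apply/properP; split.
  by apply/fintype.subsetP => l; rewrite !inE => /andP[-> /ltn_trans]; apply.
by exists i => //; rewrite !inE ?iI ?ik ?ltnn.
Qed.

Lemma rank_in_inj (d : nat) (I : {set 'I_d}) : {in I &, injective (rank_in I)}.
Proof.
move=> i k iI kI e; apply/val_inj; case: (ltngtP i k) => // h.
  by have := @rank_in_mono _ _ _ _ iI h; rewrite e ltnn.
by have := @rank_in_mono _ _ _ _ kI h; rewrite e ltnn.
Qed.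

Lemma rank_in_surj (d n : nat) (I : {set 'I_d}) (j : 'I_n) :
  #|I| = n -> exists2 i, i \in I & rank_in I i = j.
Proof.
move=> In; subst n.
have n0 : (0 < #|I|)%N by apply: leq_trans (ltn_ord j).
pose f (i : 'I_d) : 'I_#|I| := insubd (Ordinal n0) (rank_in I i).
have fE i : i \in I -> val (f i) = rank_in I i.
  by move=> iI; rewrite val_insubd rank_in_lt.
have finj : {in I &, injective f}.
  by move=> i k iI kI /(congr1 val); rewrite !fE //; apply: rank_in_inj.
have : j \in [set f i | i in I]%SET.
  have -> : [set f i | i in I]%SET = [set: 'I_#|I|]%SET.
    apply/eqP; rewrite eqEcard finset.subsetT cardsT card_ord.
    by rewrite (card_in_imset finj) leqnn.
  by rewrite inE.
by case/imsetP => i iI ->; exists i => //; rewrite fE.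
Qed.

Section sel.
Variables (R : realType) (n d : nat) (I : {set 'I_d}).
Hypothesis In : #|I| = n.
Local Notation S := (@selmx R n d I).

Lemma trmx_selmxK : S^T *m S = 1%:M.
Proof.
apply/matrixP => j k; rewrite !mxE.
have [i iI ij] := rank_in_surj j In.
rewrite (bigD1 i) //= big1 ?addr0 ?mxE ?iI ?ij ?eqxx ?mul1r //=.
move=> l li; rewrite !mxE; case: (boolP (l \in I)) => lI; rewrite ?mul0r //=.
case: eqP => e; rewrite ?mul0r //.
by case/eqP: li; apply: (@rank_in_inj _ I) => //; rewrite ij.
Qed.

Lemma selmxE (i : 'I_d) (j : 'I_n) (v : 'cV[R]_n) :
  i \in I -> rank_in I i = j -> (S *m v) i 0 = v j 0.
Proof.
move=> iI ij; rewrite mxE (bigD1 j) //= big1 ?addr0 ?mxE ?iI ?ij ?eqxx ?mul1r //.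
by move=> l lj; rewrite mxE iI ij /= eq_sym (inj_eq val_inj) (negbTE lj) mul0r.
Qed.

Lemma selmx_out (i : 'I_d) (v : 'cV[R]_n) : i \notin I -> (S *m v) i 0 = 0.
Proof.
by move=> iI; rewrite mxE big1 // => l _; rewrite mxE (negbTE iI) mul0r.
Qed.

Lemma selmx_trK (x : 'cV[R]_d) :
  (forall i, i \notin I -> x i 0 = 0) -> S *m (S^T *m x) = x.
Proof.
move=> x0; apply/matrixP => i z; rewrite (ord1 z).
case: (boolP (i \in I)) => iI; last by rewrite selmx_out // x0.
have ltr : (rank_in I i < n)%N by rewrite -In rank_in_lt.
rewrite (@selmxE i (Ordinal ltr)) // mxE (bigD1 i) //= big1 ?addr0.
  by rewrite !mxE iI eqxx mul1r.
move=> k ki; rewrite !mxE; case: (boolP (k \in I)) => kI; rewrite ?mul0r //=.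
case: eqP => e; rewrite ?mul0r //.
by case/eqP: ki; apply: (@rank_in_inj _ I).
Qed.
End sel.

Section basic.
Variables (R : realType) (m d : nat) (A : 'M[R]_(m, d)) (c : 'cV[R]_d).

Lemma costD x y : cost c (x + y) = cost c x + cost c y.
Proof. by rewrite /cost -big_split; apply: eq_bigr => i _; rewrite mxE mulrDr. Qed.

Lemma costZ a x : cost c (a *: x) = a * cost c x.
Proof. by rewrite /cost mulr_sumr; apply: eq_bigr => i _; rewrite mxE mulrCA. Qed.

Lemma costE x : cost c x = (c^T *m x) 0 0.
Proof. by rewrite mxE; apply: eq_bigr => i _; rewrite mxE. Qed.

Lemma xB_out (I : {set 'I_d}) v i : i \notin I -> xB A I v i 0 = 0.
Proof. exact: selmx_out. Qed.

Lemma A_xB (I : {set 'I_d}) v : is_basis A I -> A *m xB A I v = v.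
Proof. by move=> [_ Iu]; rewrite /xB mulmxA mulKVmx. Qed.

(** This turns any solution supported in a basis into the basic solution of that basis. *)
Lemma xB_uniq (I : {set 'I_d}) (x : 'cV[R]_d) : is_basis A I -> (forall i, i \notin I -> x i 0 = 0) ->
  xB A I (A *m x) = x.
Proof.
move=> [In Iu] x0; rewrite /xB -{1}(selmx_trK In x0).
by rewrite (mulmxA A) mulKmx // (selmx_trK In x0).
Qed.

Lemma xBD (I : {set 'I_d}) u v : xB A I (u + v) = xB A I u + xB A I v.
Proof. by rewrite /xB !mulmxDr. Qed.

Lemma xBZ (I : {set 'I_d}) a v : xB A I (a *: v) = a *: xB A I v.
Proof. by rewrite /xB -!scalemxAr. Qed.

(** The multiplier [lambdaB A c I] solves [A_I^T lambda = c_I], so reduced costs vanish on [I]. *)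
Lemma lambdaB_cost (I : {set 'I_d}) (x : 'cV[R]_d) : is_basis A I -> (forall i, i \notin I -> x i 0 = 0) ->
  ((lambdaB A c I)^T *m (A *m x)) 0 0 = cost c x.
Proof.
move=> Ib x0; have [In Iu] := Ib; rewrite costE.
rewrite /lambdaB !trmx_mul trmx_inv !trmxK -{1}(selmx_trK In x0).
rewrite (mulmxA A) -trmx_mul trmxK -/(AI A I) -(mulmxA _ (invmx _)) mulKmx //.
by rewrite -mulmxA (selmx_trK In x0).
Qed.

Lemma lambdaB_sum (I : {set 'I_d}) (y : 'cV[R]_d) : ((lambdaB A c I)^T *m (A *m y)) 0 0 =
  \sum_i (A^T *m lambdaB A c I) i 0 * y i 0.
Proof.
rewrite mulmxA mxE; apply: eq_bigr => i _; congr (_ * _).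
have -> : (lambdaB A c I)^T *m A = (A^T *m lambdaB A c I)^T by rewrite [RHS]trmx_mul trmxK.
by rewrite [LHS]mxE.
Qed.

(** The dual value [lambda^T v] equals the cost of the basic solution and is a lower bound for the
    cost of every feasible point. *)
Lemma weak_duality (I : {set 'I_d}) v : dual_feasible_basis A c I -> nonneg_vec (xB A I v) ->
  optimal A c v (xB A I v).
Proof.
move=> [Ib df] x0; split; first by split => //; exact: A_xB.
move=> y [Ay y0]; rewrite -(@lambdaB_cost I (xB A I _)) //; last exact: xB_out.
rewrite A_xB // -{1}Ay lambdaB_sum; apply: ler_sum => i _.
exact: ler_wpM2r.
Qed.

(** Linear independence of the columns of [A] indexed by [I], phrased with vectors supported in [I]
    so that it applies directly to supports of solutions. *)
Definition indep (I : {set 'I_d}) : Prop := forall y : 'cV[R]_d,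
  (forall i, i \notin I -> y i 0 = 0) -> A *m y = 0 -> y = 0.

(** An independent superset of [U] of maximal cardinality spans all columns, hence has [\rank A = m]
    elements. *)
Lemma indep_subset_basis (U : {set 'I_d}) : \rank A = m -> indep U ->
  exists2 I : {set 'I_d}, U \subset I & is_basis A I.
Proof.
move=> rA iU.
have PU : `[< indep U >] && (U \subset U) by rewrite fintype.subxx andbT; apply/asboolP.
case: (@arg_maxnP _ U (fun I : {set 'I_d} => `[< indep I >] && (U \subset I))
  (fun I => #|I|) PU) => I /andP[/asboolP iI UI] Imax.
pose B := A *m @selmx R #|I| d I.
have BT_free : row_free B^T.
  apply: inj_row_free => v vB.
  have Bv : B *m v^T = 0 by rewrite -[B]trmxK -trmx_mul vB trmx0.
  have Sv : @selmx R #|I| d I *m v^T = 0.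
    by apply: iI => [i|]; [exact: selmx_out | rewrite mulmxA].
  by rewrite -[v]trmxK -[v^T]mul1mx -(@trmx_selmxK R _ _ I) // -mulmxA Sv mulmx0 trmx0.
have span (y : 'cV[R]_d) : (forall i, i \notin I -> y i 0 = 0) -> ((A *m y)^T <= B^T)%MS.
  move=> y0; rewrite -(@selmx_trK R #|I| d I erefl y y0) mulmxA trmx_mul.
  exact: submxMl.
have AB : (A^T <= B^T)%MS.
  apply/row_subP => j; rewrite -tr_col colE.
  case: (boolP (j \in I)) => jI.
    apply: span => i iI'; rewrite mxE andbT; case: eqP => // ij.
    by rewrite ij jI in iI'.
  have : ~ indep (j |: I)%SET.
    move=> ij; have Pj : `[< indep (j |: I)%SET >] && (U \subset (j |: I)%SET).
      by apply/andP; split; [exact/asboolP | exact: fintype.subset_trans UI (finset.subsetUr _ _)].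
    by have := Imax _ Pj; rewrite /geq /= cardsU1 jI add1n ltnn.
  move=> /existsNP[y] /not_implyP[y0] /not_implyP[Ay yN0].
  have yj : y j 0 != 0.
    apply/eqP => yj; apply: yN0; apply: iI => // i iI'.
    case: (eqVneq i j) => [-> //|ij]; apply: y0.
    by rewrite !inE negb_or ij.
  (* The dependency [y] involves column [j]; normalised there, it expresses that column by the
     columns in [I]. *)
  have -> : A *m delta_mx j 0 = A *m (delta_mx j 0 - (y j 0)^-1 *: y).
    by rewrite mulmxBr -scalemxAr Ay scaler0 subr0.
  apply: span => i iI'; rewrite !mxE andbT.
  case: (eqVneq i j) => [->|ij]; first by rewrite mulVf // subrr.
  by rewrite (y0 i) ?mulr0 ?subr0 // !inE negb_or ij.
have In : #|I| = m.
  apply/eqP; rewrite eqn_leq; apply/andP; split.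
    by rewrite -(eqP BT_free) rank_leq_col.
  by rewrite -[in X in (X <= _)%N]rA -mxrank_tr -(eqP BT_free) mxrankS.
exists I => //; split=> //.
rewrite -unitmx_tr -row_free_unit; apply: inj_row_free => v vB.
have Bv : AI A I *m v^T = 0 by rewrite -[AI A I]trmxK -trmx_mul vB trmx0.
have Sv : @selmx R m d I *m v^T = 0.
  by apply: iI => [i|]; [exact: selmx_out | rewrite mulmxA].
by rewrite -[v]trmxK -[v^T]mul1mx -(@trmx_selmxK R _ _ I) // -mulmxA Sv mulmx0 trmx0.
Qed.

(** This consequence of solvability does not mention the right-hand side, so it carries over to
    perturbed ones. *)
Definition recession_bounded : Prop := forall y : 'cV[R]_d,
  nonneg_vec y -> A *m y = 0 -> 0 <= cost c y.

Lemma has_optimal_recession v : has_optimal A c v -> recession_bounded.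
Proof.
move=> [x [[Ax x0] xmin]] y y0 Ay.
have := xmin (x + y); rewrite costD lerDl; apply; split.
  by rewrite mulmxDr Ay addr0.
by move=> i; rewrite mxE addr_ge0.
Qed.

(** Induction on the size of the support: while its columns are dependent, a move along a kernel
    direction of nonpositive cost kills a coordinate. *)
Lemma support_reduction : recession_bounded -> forall x : 'cV[R]_d, nonneg_vec x ->
  exists x', [/\ nonneg_vec x', A *m x' = A *m x, cost c x' <= cost c x &
    indep [set i | x' i 0 != 0]%SET].
Proof.
move=> rb x; have [n] := ubnP #|[set i | x i 0 != 0]%SET|.
elim: n x => // n IH x; rewrite ltnS => xn x0.
case: (pselect (indep [set i | x i 0 != 0]%SET)) => [ix|]; first by exists x.
move=> /existsNP[y0] /not_implyP[y0s] /not_implyP[Ay0 y0N0].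
(* Either [y0] or [-y0] will do. A direction of negative cost has a negative coordinate by
   [recession_bounded]; at cost zero the sign is free, and one of the two has a negative coordinate
   because [y0] is nonzero. *)
have [y [ys Ay cy [i1 yi1]]] : exists y : 'cV[R]_d,
    [/\ forall i, x i 0 = 0 -> y i 0 = 0, A *m y = 0, cost c y <= 0 &
     exists i, y i 0 < 0].
  have y0s' i : x i 0 = 0 -> y0 i 0 = 0.
    by move=> xi; apply: y0s; rewrite inE xi eqxx.
  have neg (z : 'cV[R]_d) : ~ (exists i, z i 0 < 0) -> nonneg_vec z.
    by move=> zi i; rewrite leNgt; apply/negP => ?; apply: zi; exists i.
  case: (ltrgtP (cost c y0) 0) => cy.
  - exists y0; split=> //; first exact: ltW.
    by apply: contrapT => /neg /rb /(_ Ay0); rewrite leNgt cy.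
  - have Ny0E : cost c (- y0) < 0 by rewrite -scaleN1r costZ mulN1r oppr_lt0.
    exists (- y0); split.
    + by move=> i xi; rewrite mxE y0s' // oppr0.
    + by rewrite mulmxN Ay0 oppr0.
    + exact: ltW.
    + by apply: contrapT => /neg /rb; rewrite mulmxN Ay0 oppr0 leNgt Ny0E; move=> /(_ erefl).
  - case: (pselect (exists i, y0 i 0 < 0)) => [?|/neg y00].
      by exists y0; split=> //; rewrite cy.
    exists (- y0); split.
    + by move=> i xi; rewrite mxE y0s' // oppr0.
    + by rewrite mulmxN Ay0 oppr0.
    + by rewrite -scaleN1r costZ mulN1r cy oppr0.
    + apply: contrapT => /neg y0N; apply: y0N0; apply/matrixP => i j.
      rewrite (ord1 j) [RHS]mxE; apply/eqP; rewrite eq_le y00 andbT.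
      by have := y0N i; rewrite mxE oppr_ge0.
(* Ratio test: [i0] is a coordinate that reaches zero first along [y], and [t] is the length of that
   move. *)
case: (@Order.TotalTheory.arg_minP _ _ _ i1 (fun i => y i 0 < 0) (fun i => x i 0 / - y i 0) yi1) => i0 yi0 imin.
pose t := x i0 0 / - y i0 0.
have t0 : 0 <= t by rewrite divr_ge0 // oppr_ge0 ltW.
pose x' : 'cV[R]_d := x + t *: y.
have x'0 : nonneg_vec x'.
  move=> i; rewrite !mxE; case: (leP 0 (y i 0)) => yi.
    by rewrite addr_ge0 ?x0 // mulr_ge0.
  have := imin i yi; rewrite -/t ler_pdivlMr ?oppr_gt0 //.
  by rewrite mulrN -subr_ge0 opprK.
have [|z [z0 Az cz iz]] := IH x' _ x'0.
  apply: leq_trans xn; apply: proper_card; apply/properP; split.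
    apply/fintype.subsetP => i; rewrite !inE !mxE; apply: contra => /eqP xi.
    by rewrite xi ys // mulr0 addr0.
  exists i0; rewrite !inE.
    by apply/eqP => /ys e; rewrite e ltxx in yi0.
  by rewrite negbK !mxE /t invrN mulrN mulNr mulfVK ?subrr // lt_eqF.
exists z; split=> //.
  by rewrite Az mulmxDr -scalemxAr Ay scaler0 addr0.
apply: le_trans cz _; rewrite costD costZ gerDl.
exact: mulr_ge0_le0.
Qed.

Lemma basic_reduction : \rank A = m -> recession_bounded ->
  forall x : 'cV[R]_d, nonneg_vec x -> exists I, [/\ is_basis A I,
    nonneg_vec (xB A I (A *m x)) & cost c (xB A I (A *m x)) <= cost c x].
Proof.
move=> rA rb x x0.
have [z [z0 Az cz iz]] := support_reduction rb x0.
have [I sI Ib] := indep_subset_basis rA iz.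
exists I; rewrite -Az xB_uniq // => i iI; apply/eqP; apply: contraNT iI => zi.
by apply: (fintype.subsetP sI); rewrite inE.
Qed.

(** After division by the highest power of ['X], the cofactor is nonzero at 0, hence near 0 by
    continuity. *)
Lemma horner_near0_neq0 (p : {poly R}) : p != 0 -> \forall t \near 0^'+, p.[t] != 0.
Proof.
move=> p0; have [k [q]] := multiplicity_XsubC p 0; rewrite p0 /= => q0 ->.
have qc : \forall t \near 0^'+, q.[t] != 0.
  apply: (@cvgr_neq0 _ _ _ _ _ _ q.[0]) => //.
  exact/cvg_at_right_filter/continuous_horner.
near=> t; rewrite hornerM mulf_neq0 //; first by near: t.
by rewrite horner_exp !hornerE subr0 expf_neq0 // gt_eqF.
Unshelve. all: by end_near. Qed.

Lemma horner_near0_gt0 (p : {poly R}) : 0 < p.[0] -> \forall t \near 0^'+, 0 < p.[t].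
Proof.
by move=> p0; apply: (cvgr_gt p.[0]) => //; exact/cvg_at_right_filter/continuous_horner.
Qed.

(* Otherwise one could move from [xB A I u] along an edge of negative reduced
   cost. *)
Lemma nondegenerate_optimal_basis (I : {set 'I_d}) u : \rank A = m ->
  recession_bounded -> is_basis A I ->
  (forall i, i \in I -> 0 < xB A I u i 0) ->
  (forall I', is_basis A I' -> nonneg_vec (xB A I' u) ->
     cost c (xB A I u) <= cost c (xB A I' u)) ->
  dual_feasible_basis A c I.
Proof.
move=> rA rb Ib xpos xmin; split=> // j; rewrite leNgt; apply/negP => cj.
have x0 : nonneg_vec (xB A I u).
  by move=> i; case: (boolP (i \in I)) => iI; [exact/ltW/xpos | rewrite xB_out].
pose e : 'cV[R]_d := delta_mx j 0.
(* The edge direction raises coordinate [j] by one and corrects the basic coordinates to stay in the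
   kernel of [A]; its cost is the reduced cost of [j]. *)
pose y := e - xB A I (A *m e).
have Ay : A *m y = 0 by rewrite mulmxBr A_xB // subrr.
have cy : cost c y < 0.
  rewrite costD -scaleN1r costZ mulN1r -(@lambdaB_cost I (xB A I _)) //; last exact: xB_out.
  rewrite A_xB // lambdaB_sum subr_lt0 /cost (bigD1 j) //= big1 ?addr0; last first.
    by move=> i ij; rewrite mxE (negbTE ij) mulr0.
  rewrite [X in _ < X](bigD1 j) //= [X in _ < _ + X]big1 ?addr0; last first.
    by move=> i ij; rewrite [e _ _]mxE (negbTE ij) mulr0.
  by rewrite ![e _ _]mxE !eqxx !mulr1.
have [s s0 sx] : exists2 s : R, 0 < s & nonneg_vec (xB A I u + s *: y).
  have near_i : \forall s \near (0:R)^'+, forall i, 0 <= xB A I u i 0 + s * y i 0.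
    apply: filter_forall => i; case: (boolP (i \in I)) => iI.
      have := @horner_near0_gt0 ((xB A I u i 0)%:P + (y i 0)%:P * 'X).
      rewrite !hornerE => /(_ (xpos i iI)); apply: filterS => s.
      by rewrite !hornerE mulrC => /ltW.
    have yi : y i 0 = (i == j)%:R.
      by rewrite [y _ _]mxE [(- xB _ _ _) _ _]mxE xB_out // subr0 mxE andbT.
    by near=> s; rewrite xB_out // add0r yi mulr_ge0.
  have [s [s0 sP]] := filter_ex (filterI (nbhs_right_gt (0:R)) near_i).
  by exists s => // i; have := sP i; rewrite [in X in _ -> X]mxE [X in _ -> _ <= _ + X]mxE.
(* The hypothesis compares basic solutions only, so the cheaper point is first replaced by a basic
   one. *)
have [I' [I'b I'0 I'c]] := basic_reduction rA rb sx.
have E : A *m (xB A I u + s *: y) = u by rewrite mulmxDr A_xB // -scalemxAr Ay scaler0 addr0.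
rewrite E in I'0 I'c.
have := le_trans (xmin _ I'b I'0) I'c.
by rewrite costD costZ lerDl pmulr_rge0 // leNgt cy.
Unshelve. all: by end_near. Qed.

(* Perturb [v] by [A_(I0) (t, ..., t^m)], where [I0] is a primal feasible basis:
   for small [t > 0] no basic solution is degenerate. *)
Lemma has_optimal_basis v : \rank A = m -> has_optimal A c v ->
  exists2 I, dual_feasible_basis A c I & nonneg_vec (xB A I v).
Proof.
move=> rA vopt; have rb := has_optimal_recession vopt.
have [z [[Az z0] _]] := vopt.
have [I0 [I0b I00 _]] := basic_reduction rA rb z0; rewrite Az in I00.
pose w (t : R) : 'cV[R]_m := \col_j t ^+ j.+1.
pose u (t : R) := v + AI A I0 *m w t.
(* The [j]-th basic coordinate for [I] at the right-hand side [u t], as a polynomial in [t]. *)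
pose p (I : {set 'I_d}) (j : 'I_m) : {poly R} :=
  ((invmx (AI A I) *m v) j 0)%:P + 'X * \poly_(i < m) (if insub i is Some i' then (invmx (AI A I) *m AI A I0) j i' else 0).
have pE I j t : (p I j).[t] = (invmx (AI A I) *m u t) j 0.
  rewrite /p /u mulmxDr [in RHS]mxE !hornerE; congr (_ + _).
  rewrite horner_poly mulr_sumr (mulmxA _ (AI A I0)) mxE; apply: eq_bigr => i _.
  by rewrite valK [w _ _ _]mxE exprS mulrCA.
(* The coefficients of positive degree form row [j] of the invertible matrix [M], which cannot
   vanish. *)
have p_neq0 I j : is_basis A I -> p I j != 0.
  move=> [_ Iu]; apply/eqP => p0.
  have [_ I0u] := I0b.
  pose M := invmx (AI A I) *m AI A I0.
  have Mu : M \in unitmx by rewrite unitmx_mul unitmx_inv Iu.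
  have M0 i : M j i = 0.
    have /(congr1 (fun q : {poly R} => q`_i.+1)) := p0.
    by rewrite coefD coefC /= add0r coefXM /= coef_poly ltn_ord valK coef0.
  have : (M *m invmx M) j j = 0.
    by rewrite mxE big1 // => i _; rewrite M0 mul0r.
  by rewrite mulmxV // mxE eqxx => /eqP; rewrite oner_eq0.
have near1 : \forall t \near (0:R)^'+, forall I, forall j, is_basis A I -> (p I j).[t] != 0.
  apply: filter_forall => I; apply: filter_forall => j.
  case: (pselect (is_basis A I)) => Ib; last by near=> t.
  by apply: filterS (horner_near0_neq0 (p_neq0 I j Ib)).
(* By contraposition, a basis that is primal feasible at [u t] is primal feasible at [v]. *)
have near2 : \forall t \near (0:R)^'+, forall I, forall j, (p I j).[0] < 0 -> (p I j).[t] < 0.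
  apply: filter_forall => I; apply: filter_forall => j.
  case: (ltP (p I j).[0] 0) => [h|_]; last by near=> t.
  have := @horner_near0_gt0 (- p I j); rewrite hornerN oppr_gt0 => /(_ h).
  by apply: filterS => t; rewrite hornerN oppr_gt0.
have [t [t0 [tN0 tneg]]] := filter_ex (filterI (nbhs_right_gt (0:R)) (filterI near1 near2)).
have u0 : u 0 = v.
  rewrite /u (_ : w 0 = 0) ?mulmx0 ?addr0 //.
  by apply/matrixP => i k; rewrite !mxE expr0n.
(* In the basis [I0] the perturbation adds the nonnegative vector [w t]; this keeps [I0] feasible,
   so the minimum below is over a nonempty family. *)
have I0t : nonneg_vec (xB A I0 (u t)).
  move=> i; rewrite xBD mxE addr_ge0 // /xB mulKmx; last by case: I0b.
  rewrite mxE sumr_ge0 // => j _; rewrite !mxE mulr_ge0 ?ler0n //.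
  by rewrite exprn_ge0 // ltW.
pose Q (I : {set 'I_d}) := `[< is_basis A I /\ nonneg_vec (xB A I (u t)) >].
have QI0 : Q I0 by apply/asboolP.
case: (@Order.TotalTheory.arg_minP _ _ _ I0 Q (fun I => cost c (xB A I (u t))) QI0).
move=> I /asboolP[Ib It] Imin.
have xBE (s : R) i (iI : i \in I) (lt_i : (rank_in I i < m)%N) :
    xB A I (u s) i 0 = (p I (Ordinal lt_i)).[s].
  by rewrite pE /xB (selmxE _ iI (j := Ordinal lt_i)).
have ltI i : i \in I -> (rank_in I i < m)%N.
  by have [Im _] := Ib => iI; rewrite -[X in (_ < X)%N]Im rank_in_lt.
exists I.
  apply: (nondegenerate_optimal_basis (u := u t)) => //.
    move=> i iI; rewrite lt_neqAle It andbT eq_sym (xBE _ _ iI (ltI i iI)).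
    exact: tN0.
  by move=> I' I'b I't; apply: Imin; apply/asboolP.
move=> i; case: (boolP (i \in I)) => iI; last by rewrite xB_out.
rewrite leNgt; apply/negP; rewrite -u0 (xBE _ _ iI (ltI i iI)) => /tneg.
by rewrite -(xBE t i iI) ltNge It.
Unshelve. all: by end_near. Qed.

End basic.

(** * Measurability and expectations of bounded functions *)

(** Borel measurability without a sigma-algebra on the target, which is an arbitrary topological
    space as in [cvg_dist]. *)
Definition open_measurable_map (dT : measure_display) (T : measurableType dT)
  (V : topologicalType) (Z : T -> V) : Prop :=
  forall U : set V, open U -> measurable (Z @^-1` U).

Section open_measurable_map.
Variables (R : realType) (dT : measure_display) (T : measurableType dT).

(** An open set is the countable union of the balls it contains with centre [q i] and radius
    [1 / (n + 1)]. *)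
Lemma open_measurable_map_dense (V : pseudoMetricType R) (Q : countType)
  (q : Q -> V) (Z : T -> V) :
  (forall (v : V) (e : R), 0 < e -> exists i, ball (q i) e v) ->
  (forall i (e : R), measurable (Z @^-1` ball (q i) e)) ->
  open_measurable_map Z.
Proof.
move=> qd mq U oU.
pose F (s : Q * nat) : set T :=
  if `[< ball (q s.1) (s.2.+1%:R^-1 : R) `<=` U >] then Z @^-1` ball (q s.1) s.2.+1%:R^-1
  else set0.
have -> : Z @^-1` U = \bigcup_s F s.
  apply/seteqP; split => [w /= Uw|w [s _]]; last first.
    by rewrite /F; case: asboolP => // sU /sU.
  have /nbhs_ballP[e /= e0 eU] : nbhs (Z w) U by apply: open_nbhs_nbhs.
  (* A radius below [e / 2] keeps the whole ball around [q i] within distance [e] of [Z w]. *)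
  have [n _ /(_ n (leqnn n)) nP] := near_infty_natSinv_lt (PosNum (divr_gt0 e0 (@ltr0n R 2))).
  have n0 : 0 < n.+1%:R^-1 :> R by rewrite invr_gt0 ltr0n.
  have [i iw] := qd (Z w) _ n0.
  exists (i, n) => //; rewrite /F /=; case: asboolP => // -[] v iv.
  apply: eU; rewrite [e]splitr.
  apply: (@ball_triangle _ _ (q i)).
    by apply: (le_ball (ltW nP)); exact: ball_sym.
  exact: (le_ball (ltW nP)).
apply: countable_bigcupT_measurable => [|s]; first exact: countableP.
by rewrite /F; case: asboolP.
Qed.

Lemma measurable_ball_matrix k l (Z : T -> 'M[R]_(k, l)) (x : 'M[R]_(k, l)) (e : R) :
  (forall i j, measurable_fun setT (fun w => Z w i j)) ->
  measurable (Z @^-1` ball x e).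
Proof.
move=> mZ; case: (ltP 0 e) => e0; last first.
  rewrite (_ : _ @^-1` _ = set0) //; apply/seteqP; split => // w [] /=.
  by rewrite ltNge e0.
have -> : Z @^-1` ball x e =
    \bigcap_(p in [set: 'I_k * 'I_l]) ((fun w => Z w p.1 p.2) @^-1` ball (x p.1 p.2) e).
  apply/seteqP; split => [w [_ wb] [i j] _|w wb]; first exact: wb.
  by split => // i j; apply: (wb (i, j)).
apply: fin_bigcap_measurable => [|[i j] _ /=]; first exact: finite_finset.
rewrite -[X in measurable X]setTI; apply: mZ => //.
exact: (open_measurable (ball_open (x i j) e)).
Qed.

Lemma rat_matrix_dense k l (v : 'M[R]_(k, l)) (e : R) : 0 < e ->
  exists Q : 'M[rat]_(k, l), ball (map_mx ratr Q : 'M[R]_(k, l)) e v.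
Proof.
move=> e0.
have ex i j : exists q : rat, ball (ratr q : R) e (v i j).
  have /rat_in_itvoo[q] : v i j - e < v i j + e by lra.
  rewrite in_itv /= => /andP[q1 q2]; exists q.
  by rewrite /ball /= ltr_norml; apply/andP; split; lra.
exists (\matrix_(i, j) xchoose (ex i j)); split => // i j.
by rewrite !mxE; exact: (xchooseP (ex i j)).
Qed.

Lemma open_measurable_matrix k l (Z : T -> 'M[R]_(k, l)) :
  (forall i j, measurable_fun setT (fun w => Z w i j)) -> open_measurable_map Z.
Proof.
move=> mZ; apply: (@open_measurable_map_dense _ _ (fun Q : 'M[rat]_(k, l) => map_mx ratr Q : 'M[R]_(k, l))).
  by move=> v e; exact: rat_matrix_dense.
by move=> Q e; exact: measurable_ball_matrix.
Qed.

Lemma open_measurable_matrix_pair k l k' l' (Z : T -> 'M[R]_(k, l)) (Z' : T -> 'M[R]_(k', l')) :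
  (forall i j, measurable_fun setT (fun w => Z w i j)) ->
  (forall i j, measurable_fun setT (fun w => Z' w i j)) ->
  open_measurable_map (fun w => (Z w, Z' w)).
Proof.
move=> mZ mZ'.
pose q (Q : 'M[rat]_(k, l) * 'M[rat]_(k', l')) : 'M[R]_(k, l) * 'M[R]_(k', l') :=
  (map_mx ratr Q.1, map_mx ratr Q.2).
apply: (@open_measurable_map_dense _ _ q).
  move=> [v v'] e e0.
  have [Q QP] := rat_matrix_dense v e0; have [Q' QP'] := rat_matrix_dense v' e0.
  by exists (Q, Q').
move=> [Q Q'] e.
have -> : (fun w => (Z w, Z' w)) @^-1` ball (q (Q, Q')) e =
  Z @^-1` ball (map_mx ratr Q : 'M[R]_(k, l)) e `&` Z' @^-1` ball (map_mx ratr Q' : 'M[R]_(k', l')) e.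
  by apply/seteqP; split=> w.
by apply: measurableI; exact: measurable_ball_matrix.
Qed.

Lemma measurable_continuous_comp (V : topologicalType) (Z : T -> V) (f : V -> R) :
  open_measurable_map Z -> continuous f -> measurable_fun setT (fun w => f (Z w)).
Proof.
move=> mZ /continuousP cf; apply: (measurability _ (RGenOpens.measurableE R)).
move=> _ [_ [a [b ->] <-]]; rewrite setTI -[X in measurable X]/(Z @^-1` (f @^-1` `]a, b[)).
exact/mZ/cf/interval_open.
Qed.

End open_measurable_map.

Definition bounded_measurable (R : realType) (dT : measure_display)
  (T : measurableType dT) (g : T -> R) : Prop :=
  measurable_fun setT g /\ exists M : R, forall w, `|g w| <= M.

Section bounded_integrals.
Variables (R : realType) (dT : measure_display) (T : measurableType dT).
Variable P : probability T R.
Implicit Types g : T -> R.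

Lemma bounded_measurable_integrable g :
  bounded_measurable g -> P.-integrable setT (EFin \o g).
Proof.
move=> [mg [M gM]]; apply: measurable_bounded_integrable => //.
  exact: le_lt_trans (probability_le1 P measurableT) (ltry _).
exists M; split; first exact: num_real.
by move=> x Mx w _; apply: le_trans (gM w) (ltW Mx).
Qed.

Lemma bounded_measurable_cst (a : R) : bounded_measurable (fun _ : T => a).
Proof. by split=> //; exists `|a|. Qed.

Lemma bounded_measurableD g1 g2 : bounded_measurable g1 -> bounded_measurable g2 ->
  bounded_measurable (fun w => g1 w + g2 w).
Proof.
move=> [m1 [M1 h1]] [m2 [M2 h2]]; split; first exact: measurable_funD.
by exists (M1 + M2) => w; apply: le_trans (ler_normD _ _) (lerD _ _).
Qed.

Lemma bounded_measurableZ (a : R) g : bounded_measurable g ->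
  bounded_measurable (fun w => a * g w).
Proof.
move=> [m1 [M1 h1]]; split; first exact: measurable_funM.
by exists (`|a| * M1) => w; rewrite normrM ler_wpM2l.
Qed.

Lemma bounded_measurable_sum (I : Type) (s : seq I) (g : I -> T -> R) :
  (forall i, bounded_measurable (g i)) ->
  bounded_measurable (fun w => \sum_(i <- s) g i w).
Proof.
move=> bg; elim: s => [|i s IH].
  rewrite (_ : (fun w => _) = (fun=> 0)); first exact: bounded_measurable_cst.
  by apply/funext => w; rewrite big_nil.
rewrite (_ : (fun w => _) = (fun w => g i w + \sum_(i <- s) g i w)).
  exact: bounded_measurableD.
by apply/funext => w; rewrite big_cons.
Qed.

Lemma bounded_measurable_indic (B : set T) : measurable B ->
  bounded_measurable (\1_B : T -> R).
Proof.
move=> mB; split; first exact: measurable_indic.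
by exists 1 => w; rewrite indicE; case: (_ \in _); rewrite /= ?normr1 // normr0 ler01.
Qed.

Lemma bounded_measurable_comp (V : topologicalType) (Z : T -> V) (f : V -> R) :
  open_measurable_map Z -> continuous f -> (exists M : R, forall v, `|f v| <= M) ->
  bounded_measurable (fun w => f (Z w)).
Proof.
move=> mZ cf [M fM]; split; first exact: (measurable_continuous_comp mZ cf).
by exists M => w.
Qed.

Lemma bounded_integralE g : bounded_measurable g ->
  (\int[P]_w (g w)%:E)%E = (\int[P]_w g w)%:E.
Proof.
move=> bg; rewrite /Rintegral fineK //; apply: integrable_fin_num => //.
exact: bounded_measurable_integrable.
Qed.

Lemma bounded_RintegralD g1 g2 : bounded_measurable g1 -> bounded_measurable g2 ->
  \int[P]_w (g1 w + g2 w) = \int[P]_w g1 w + \int[P]_w g2 w.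
Proof. by move=> b1 b2; apply: RintegralD => //; exact: bounded_measurable_integrable. Qed.

Lemma bounded_RintegralZ (a : R) g : bounded_measurable g ->
  \int[P]_w (a * g w) = a * \int[P]_w g w.
Proof. by move=> b1; apply: RintegralZl => //; exact: bounded_measurable_integrable. Qed.

Lemma bounded_Rintegral_sum (I : Type) (s : seq I) (g : I -> T -> R) :
  (forall i, bounded_measurable (g i)) ->
  \int[P]_w (\sum_(i <- s) g i w) = \sum_(i <- s) \int[P]_w g i w.
Proof.
move=> bg; elim: s => [|i s IH].
  rewrite big_nil (_ : (fun w => _) = (fun=> 0)); last first.
    by apply/funext => w; rewrite big_nil.
  by rewrite Rintegral_cst // mul0r.
rewrite big_cons -IH -bounded_RintegralD //; last exact: bounded_measurable_sum.
by congr Rintegral; apply/funext => w; rewrite big_cons.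
Qed.

Lemma le_bounded_Rintegral g1 g2 : bounded_measurable g1 -> bounded_measurable g2 ->
  (forall w, g1 w <= g2 w) -> \int[P]_w g1 w <= \int[P]_w g2 w.
Proof.
by move=> b1 b2 g12; apply: le_Rintegral => //; exact: bounded_measurable_integrable.
Qed.

Lemma le_norm_bounded_Rintegral g1 g2 : bounded_measurable g1 -> bounded_measurable g2 ->
  (forall w, `|g1 w| <= g2 w) -> `|\int[P]_w g1 w| <= \int[P]_w g2 w.
Proof.
move=> b1 b2 g12; rewrite ler_norml; apply/andP; split.
  rewrite lerNl -mulN1r -bounded_RintegralZ //.
  apply: le_bounded_Rintegral => //; first exact: bounded_measurableZ.
  by move=> w; rewrite mulN1r; apply: le_trans (g12 w); rewrite -normrN ler_norm.
by apply: le_bounded_Rintegral => // w; apply: le_trans (g12 w); rewrite ler_norm.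
Qed.

Lemma Rintegral_indic (B : set T) : measurable B ->
  \int[P]_w (\1_B w : R) = fine (P B).
Proof. by move=> mB; rewrite /Rintegral integral_indic // setIT. Qed.

Lemma Rintegral_cvg0 (g : nat -> T -> R) (M : R) (D : set T) :
  (forall n, measurable_fun setT (g n)) -> (forall n w, `|g n w| <= M) ->
  measurable D -> P D = 0%E -> (forall w, ~ D w -> g ^~ w @ \oo --> 0) ->
  (fun n => \int[P]_w g n w) @ \oo --> 0.
Proof.
move=> mg gM mD D0 gD.
have ae : \forall w \ae P, setT w -> (g n w)%:E @[n --> \oo] --> 0%E.
  exists D; split=> // w /= H; apply: contrapT => Dw; apply: H => _.
  by apply: cvg_EFin; [near=> n | exact: gD].
have iM : P.-integrable setT (cst M%:E).
  exact: (bounded_measurable_integrable (bounded_measurable_cst M)).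
have [_ _ H] := dominated_convergence measurableT
  (fun n => (measurable_EFinP _ _).2 (mg n)) (measurable_cst _) ae iM
  (aeW _ (fun w n _ => gM n w)).
rewrite integral0 in H.
exact: fine_cvg H.
Unshelve. all: by end_near. Qed.

End bounded_integrals.

(** * Convergence in distribution of piecewise continuous functions *)

Section clamp.
Variables (R : realType) (e : R).
Hypothesis e0 : 0 < e.

(** [ramp] approximates the indicator of positive numbers continuously; for [0 <= t] its defect
    [1 - ramp t] is exactly [tent t], a bump supported within [e] of 0. *)
Definition ramp (t : R) : R := Num.min 1 (Num.max 0 (t / e)).
Definition tent (t : R) : R := Num.max 0 (1 - `|t| / e).

Lemma ramp_neg t : t <= 0 -> ramp t = 0.
Proof.
move=> t0; rewrite /ramp (max_idPl _) ?min_r //.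
by rewrite pmulr_lle0 ?invr_gt0.
Qed.

Lemma ramp_bound t : `|ramp t| <= 1.
Proof.
rewrite /ramp; case: (leP (t / e) 0) => h; first by rewrite min_r // normr0.
by case: (leP (t / e) 1) => h'; rewrite ger0_norm // ltW.
Qed.

Lemma tent_ge0 t : 0 <= tent t.
Proof. by rewrite /tent le_max lexx. Qed.

Lemma tent_bound t : `|tent t| <= 1.
Proof.
rewrite ger0_norm ?tent_ge0 // /tent ge_max ler01 /= gerBl.
by rewrite mulr_ge0 // invr_ge0 ltW.
Qed.

Lemma tent_ramp t : 0 <= t -> 1 - ramp t = tent t.
Proof.
move=> t0; rewrite /ramp /tent ger0_norm //.
have h : 0 <= t / e by rewrite mulr_ge0 // invr_ge0 ltW.
rewrite (max_idPr h); case: (leP 1 (t / e)) => h'.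
  by rewrite (max_idPl _) ?subrr // subr_le0.
by rewrite (max_idPr _) // subr_ge0 ltW.
Qed.

Lemma tent_far t : e <= `|t| -> tent t = 0.
Proof.
by move=> et; rewrite /tent (max_idPl _) // subr_le0 ler_pdivlMr // mul1r.
Qed.

Lemma ramp_continuous (V : topologicalType) (h : V -> R) :
  continuous h -> continuous (fun v => ramp (h v)).
Proof.
move=> ch v; apply: (@continuous_min _ _ (fun=> 1) (fun v => Num.max 0 (h v / e))).
  exact: cvg_cst.
apply: (@continuous_max _ _ (fun=> 0) (fun v => h v / e)); first exact: cvg_cst.
by apply: cvgMr_tmp; exact: ch.
Qed.

Lemma tent_continuous (V : topologicalType) (h : V -> R) :
  continuous h -> continuous (fun v => tent (h v)).
Proof.
move=> ch v; apply: (@continuous_max _ _ (fun=> 0) (fun v => 1 - `|h v| / e)).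
  exact: cvg_cst.
apply: cvgB; first exact: cvg_cst.
by apply: cvgMr_tmp; apply: cvg_norm; exact: ch.
Qed.

End clamp.

(** Only the term [j0] survives, since ramps vanish at nonpositive arguments, and its defect is a
    tent. Summing all tents makes the bound independent of the active index [j0]. *)
Lemma ramp_partition_bound (R : realType) (J : finType) (e M a : R) (t b : J -> R) (j0 : J) :
  0 < e -> (forall j, `|b j| <= M) -> a = b j0 -> 0 <= t j0 ->
  (forall j, j != j0 -> t j <= 0) ->
  `|a - \sum_j b j * ramp e (t j)| <= M * \sum_j tent e (t j).
Proof.
move=> e0 bM -> tj0 tj; rewrite (bigD1 j0) //= big1 ?addr0; last first.
  by move=> j jj0; rewrite ramp_neg ?mulr0 // tj.
rewrite -{1}[b j0]mulr1 -mulrBr tent_ramp // normrM (ger0_norm (tent_ge0 _ _)).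
have M0 : 0 <= M by apply: le_trans (normr_ge0 _) (bM j0).
apply: ler_pM => //; first exact: tent_ge0.
rewrite (bigD1 j0) //= lerDl; apply: sumr_ge0 => j _; exact: tent_ge0.
Qed.

Lemma cvg_sum_fin (R : realType) (X : Type) (F : set_system X) {FF : Filter F}
  (I : Type) (s : seq I) (f : I -> X -> R) (a : I -> R) :
  (forall i, f i @ F --> a i) ->
  (fun x => \sum_(i <- s) f i x) @ F --> \sum_(i <- s) a i.
Proof.
move=> fa; elim: s => [|i s IH].
  rewrite big_nil (_ : (fun x => _) = (fun=> 0)); first exact: cvg_cst.
  by apply/funext => x; rewrite big_nil.
rewrite big_cons (_ : (fun x => _) = (fun x => f i x + \sum_(i <- s) f i x)).
  exact: cvgD.
by apply/funext => x; rewrite big_cons.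
Qed.

(** The error bound [p n] need not be small for every [n]; it is enough that its limit is, as
    happens for integrals of tents of a fixed width. *)
Lemma cvg_of_approx (R : realType) (a : nat -> R) (l : R) :
  (forall e : R, 0 < e -> exists s p : nat -> R, exists s' p' : R,
    [/\ s @ \oo --> s', p @ \oo --> p', p' < e, `|l - s'| <= p' &
        forall n, `|a n - s n| <= p n]) ->
  a @ \oo --> l.
Proof.
move=> H; apply/cvgrPdist_lt => e e0.
(* One quarter each for the distances of [l] to [s'] and of [s'] to [s n], and two for [p n], which
   is below [p' + e / 4]. *)
have e4 : 0 < e / 4 by rewrite divr_gt0.
have [s [p [s' [p' [ss pp p'e ls as_]]]]] := H _ e4.
near=> n.
have h1 : `|s' - s n| < e / 4 by near: n; move/cvgrPdist_lt : ss; apply.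
have h2 : `|p' - p n| < e / 4 by near: n; move/cvgrPdist_lt : pp; apply.
have h3 := as_ n.
move: ls h1 h2 h3; rewrite !ler_norml !ltr_norml => /andP[? ?] /andP[? ?] /andP[? ?] /andP[? ?].
by apply/andP; split; lra.
Unshelve. all: by end_near. Qed.

Section cvg_dist.
Variables (R : realType) (dT : measure_display) (T : measurableType dT) (P : probability T R).
Variables (dT' : measure_display) (T' : measurableType dT') (P' : probability T' R).

Lemma cvg_dist_Rintegral (V : topologicalType) (X : nat -> T -> V) (Y : T' -> V) (f : V -> R) :
  cvg_dist P X P' Y -> (forall n, open_measurable_map (X n)) -> open_measurable_map Y ->
  continuous f -> (exists M : R, forall v, `|f v| <= M) ->
  (fun n => \int[P]_w f (X n w)) @ \oo --> \int[P']_w f (Y w).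
Proof.
move=> XY mX mY cf bf; have := XY f cf bf.
rewrite bounded_integralE; last exact: bounded_measurable_comp.
by move=> /fine_cvg.
Qed.

Lemma Rintegral_cvg_dist (V : topologicalType) (X : nat -> T -> V) (Y : T' -> V) :
  (forall n, open_measurable_map (X n)) -> open_measurable_map Y ->
  (forall f : V -> R, continuous f -> (exists M : R, forall v, `|f v| <= M) ->
    (fun n => \int[P]_w f (X n w)) @ \oo --> \int[P']_w f (Y w)) ->
  cvg_dist P X P' Y.
Proof.
move=> mX mY H f cf bf; rewrite bounded_integralE; last exact: bounded_measurable_comp.
apply: cvg_EFin; last exact: H.
by near=> n; rewrite bounded_integralE //; exact: bounded_measurable_comp.
Unshelve. all: by end_near. Qed.

Lemma tent_integral_cvg0 (V : topologicalType) (Z : T' -> V) (h : V -> R) :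
  open_measurable_map Z -> continuous h -> P' [set w | h (Z w) = 0] = 0%E ->
  (fun k => \int[P']_w tent k.+1%:R^-1 (h (Z w))) @ \oo --> 0.
Proof.
move=> mZ ch h0.
have i0 k : 0 < k.+1%:R^-1 :> R by rewrite invr_gt0 ltr0n.
apply: (@Rintegral_cvg0 _ _ _ _ _ 1 [set w | h (Z w) = 0]) => //.
- move=> n; exact: (measurable_continuous_comp mZ (@tent_continuous _ n.+1%:R^-1 _ _ ch)).
- by move=> n w; exact: tent_bound.
- have := measurable_continuous_comp mZ ch measurableT (measurable_set1 (0:R)).
  by rewrite setTI.
move=> w /= hw; apply: (@cvg_near_cst _ _ (0:R)).
have hp : 0 < `|h (Z w)| by rewrite normr_gt0; apply/eqP.
near=> n; apply: tent_far => //; apply: ltW; near: n.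
exact: (near_infty_natSinv_lt (PosNum hp)).
Unshelve. all: by end_near. Qed.

(* Replacing the indicator of the [j]-th piece [h_j >= 0] by a ramp of width [e]
   costs at most the integral of a tent around [h_j = 0], which vanishes as
   [e -> 0] because the limit law does not charge [h_j = 0]. *)
Theorem cvg_dist_piecewise (V W : topologicalType) (J : finType)
  (Z : J -> nat -> T -> V) (Z' : J -> T' -> V) (h : J -> V -> R) (u : J -> V -> W)
  (X : nat -> T -> W) (Y : T' -> W) (B : nat -> set T) :
  (forall j n, open_measurable_map (Z j n)) -> (forall j, open_measurable_map (Z' j)) ->
  (forall n, open_measurable_map (X n)) -> open_measurable_map Y ->
  (forall j, continuous (h j)) -> (forall j, continuous (u j)) ->
  (forall j, cvg_dist P (Z j) P' (Z' j)) ->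
  (forall j, P' [set w | h j (Z' j w) = 0] = 0%E) ->
  (forall n, measurable (B n)) -> (fun n => P (~` B n)) @ \oo --> 0%E ->
  (forall n w, B n w -> exists j0, [/\ X n w = u j0 (Z j0 n w), 0 <= h j0 (Z j0 n w) &
     forall j, j != j0 -> h j (Z j n w) <= 0]) ->
  (forall w, exists j0, [/\ Y w = u j0 (Z' j0 w), 0 <= h j0 (Z' j0 w) &
     forall j, j != j0 -> h j (Z' j w) <= 0]) ->
  cvg_dist P X P' Y.
Proof.
move=> mZ mZ' mX mY ch cu ZZ' h0 mB PB XE YE.
apply: Rintegral_cvg_dist => // f cf [M0 fM0].
pose M := `|M0|.
have fM v : `|f v| <= M by apply: le_trans (fM0 v) (ler_norm _).
have M_ge0 : 0 <= M by exact: normr_ge0.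
pose F e j v := f (u j v) * ramp e (h j v).
have cF e j : 0 < e -> continuous (F e j).
  move=> e0 v; apply: (@continuousM _ _ (fun v => f (u j v)) (fun v => ramp e (h j v))).
    by apply: continuous_comp; [exact: cu | exact: cf].
  exact: ramp_continuous.
have FM e j v : 0 < e -> `|F e j v| <= M.
  by move=> e0; rewrite normrM -[M]mulr1 ler_pM // ramp_bound.
have ctent e j : 0 < e -> continuous (fun v => tent e (h j v)).
  by move=> e0; apply: tent_continuous.
have btent e : 0 < e -> exists M : R, forall t, `|tent e t| <= M.
  by move=> e0; exists 1; exact: tent_bound.
(* A crude bound for the approximation error off [B n]: [M] for [f] and [M] for each of the [#|J|]
   truncated pieces. *)
pose C := M + M * #|J|%:R.
apply: cvg_of_approx => d d0.
(* The width is chosen from the limit law alone, before [n] tends to infinity. *)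
have [k hk] : exists k, M * \sum_j \int[P']_w tent k.+1%:R^-1 (h j (Z' j w)) < d.
  have tc : (fun k => M * \sum_j \int[P']_w tent k.+1%:R^-1 (h j (Z' j w))) @ \oo --> (0:R).
    have E0 : (0:R) = M * \sum_(j : J) 0 by rewrite big1 ?mulr0.
    rewrite [X in _ --> X]E0.
    apply: cvgMl_tmp; apply: cvg_sum_fin => j; apply: tent_integral_cvg0 => //.
  have : \forall k \near \oo, M * \sum_j \int[P']_w tent k.+1%:R^-1 (h j (Z' j w)) < d.
    exact: (cvgr_lt _ tc).
  by move=> [k _ /(_ k (leqnn k))]; exists k.
pose e : R := k.+1%:R^-1.
have e0 : 0 < e by rewrite invr_gt0 ltr0n.
exists (fun n => \sum_j \int[P]_w F e j (Z j n w)).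
exists (fun n => M * (\sum_j \int[P]_w tent e (h j (Z j n w))) + C * fine (P (~` B n))).
exists (\sum_j \int[P']_w F e j (Z' j w)).
exists (M * \sum_j \int[P']_w tent e (h j (Z' j w))).
have bFZ n j : bounded_measurable (fun w => F e j (Z j n w)).
  by apply: bounded_measurable_comp; [exact: mZ | exact: cF | exists M => v; exact: FM].
have bFZ' j : bounded_measurable (fun w => F e j (Z' j w)).
  by apply: bounded_measurable_comp; [exact: mZ' | exact: cF | exists M => v; exact: FM].
have btZ n j : bounded_measurable (fun w => tent e (h j (Z j n w))).
  by apply: (bounded_measurable_comp (mZ j n)) (ctent e j e0) _; exists 1 => v; exact: tent_bound.
have btZ' j : bounded_measurable (fun w => tent e (h j (Z' j w))).
  by apply: (bounded_measurable_comp (mZ' j)) (ctent e j e0) _; exists 1 => v; exact: tent_bound.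
have bfX n : bounded_measurable (fun w => f (X n w)).
  by apply: bounded_measurable_comp; [exact: mX | exact: cf | exists M].
have bfY : bounded_measurable (fun w => f (Y w)).
  by apply: bounded_measurable_comp; [exact: mY | exact: cf | exists M].
split => //.
- apply: cvg_sum_fin => j; apply: cvg_dist_Rintegral => //; first exact: cF.
  by exists M => v; exact: FM.
- rewrite -[X in _ --> X]addr0 -[X in _ --> _ + X](mulr0 C); apply: cvgD.
    apply: cvgMl_tmp; apply: cvg_sum_fin => j.
    apply: (cvg_dist_Rintegral (f := fun v => tent e (h j v))) => //; first exact: ctent.
    by exists 1 => v; exact: tent_bound.
  by apply: cvgMl_tmp; exact: fine_cvg PB.
- rewrite -bounded_Rintegral_sum // -mulN1r -bounded_RintegralZ; last exact: bounded_measurable_sum.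
  have bS := bounded_measurable_sum (index_enum J) bFZ'.
  have bT := bounded_measurable_sum (index_enum J) btZ'.
  rewrite -bounded_RintegralD //; last exact: bounded_measurableZ.
  rewrite -bounded_Rintegral_sum // -bounded_RintegralZ //.
  apply: le_norm_bounded_Rintegral.
  + by apply: bounded_measurableD => //; exact: bounded_measurableZ.
  + exact: bounded_measurableZ.
  move=> w; rewrite mulN1r; have [j0 [Yj0 hj0 hj]] := YE w.
  apply: (ramp_partition_bound e0 _ _ hj0 hj) => [j|]; first exact: fM.
  by rewrite Yj0.
move=> n; rewrite -bounded_Rintegral_sum // -mulN1r -bounded_RintegralZ; last exact: bounded_measurable_sum.
have bS := bounded_measurable_sum (index_enum J) (bFZ n).
have bT := bounded_measurable_sum (index_enum J) (btZ n).
have mBC : measurable (~` B n) by exact: measurableC.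
have bI := @bounded_measurable_indic R _ _ _ mBC.
rewrite -bounded_RintegralD //; last exact: bounded_measurableZ.
rewrite -bounded_Rintegral_sum // -bounded_RintegralZ // -Rintegral_indic //.
rewrite -[X in _ + X]bounded_RintegralZ // -bounded_RintegralD; last 2 first.
- exact: bounded_measurableZ.
- exact: bounded_measurableZ.
apply: le_norm_bounded_Rintegral.
- by apply: bounded_measurableD => //; exact: bounded_measurableZ.
- by apply: bounded_measurableD; exact: bounded_measurableZ.
move=> w; rewrite mulN1r.
have C0 : 0 <= C by rewrite addr_ge0 // mulr_ge0.
case: (pselect (B n w)) => Bw.
  have [j0 [Xj0 hj0 hj]] := XE n w Bw.
  apply: le_trans (_ : M * (\sum_j tent e (h j (Z j n w))) <= _); last first.
    by rewrite lerDl mulr_ge0 // indicE.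
  apply: (ramp_partition_bound e0 _ _ hj0 hj) => [j|]; first exact: fM.
  by rewrite Xj0.
rewrite indicE mem_set // mulr1.
apply: le_trans (_ : C <= _); last first.
  rewrite lerDr mulr_ge0 //; apply: sumr_ge0 => j _; exact: tent_ge0.
apply: le_trans (ler_normB _ _) _; apply: lerD; first exact: fM.
apply: le_trans (ler_norm_sum _ _ _) _.
apply: le_trans (_ : \sum_(j : J) M <= _); last by rewrite sumr_const mulr_natr.
by apply: ler_sum => j _; exact: FM.
Qed.

(** The indicator of [c n <= |X n|] is eventually below a fixed continuous cutoff [g k], whose
    expectation converges to that under the limit law, small for large [k]. *)
Lemma cvg_dist_tight (V : pseudoMetricNormedZmodType R) (X : nat -> T -> V) (Y : T' -> V)
  (c : nat -> R) :
  (forall n, open_measurable_map (X n)) -> open_measurable_map Y ->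
  cvg_dist P X P' Y -> c @ \oo --> +oo ->
  (fun n => P [set w | c n <= `|X n w|]) @ \oo --> 0%E.
Proof.
move=> mX mY XY coo.
have mS n : measurable [set w | c n <= `|X n w|].
  have := measurable_continuous_comp (mX n) (@norm_continuous _ V) measurableT
    (measurable_itv `[c n, +oo[).
  rewrite setTI (_ : _ @^-1` _ = [set w | c n <= `|X n w|]) //.
  by apply/seteqP; split => w /=; rewrite in_itv /= andbT.
have bS n := @bounded_measurable_indic R _ _ _ (mS n).
pose g (k : nat) (v : V) := ramp 1 (`|v| - k%:R).
have cg k : continuous (g k).
  apply: ramp_continuous => v; apply: cvgB; last exact: cvg_cst.
  exact: norm_continuous.
have bg k : exists M : R, forall v, `|g k v| <= M by exists 1 => v; exact: ramp_bound.
have bgX k n : bounded_measurable (fun w => g k (X n w)).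
  exact: bounded_measurable_comp.
have g_ge0 k v : 0 <= g k v by rewrite /g /ramp le_min ler01 le_max lexx.
suff H : (fun n => fine (P [set w | c n <= `|X n w|])) @ \oo --> 0.
  apply: cvg_EFin; last exact: H.
  by near=> n; exact: fin_num_measure.
have gY : (fun k => \int[P']_w g k (Y w)) @ \oo --> 0.
  apply: (@Rintegral_cvg0 _ _ _ _ _ 1 set0) => //.
  - by move=> k; exact: (measurable_continuous_comp mY (cg k)).
  - by move=> k w; exact: ramp_bound.
  move=> w _; apply: (@cvg_near_cst _ _ (0:R)); near=> k.
  apply: ramp_neg => //; rewrite subr_le0; near: k; exact: nbhs_infty_ger.
apply/cvgrPdist_lt => d d0.
have [k kd] : exists k, \int[P']_w g k (Y w) < d.
  have : \forall k \near \oo, \int[P']_w g k (Y w) < d by exact: (cvgr_lt _ gY).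
  by move=> [k _ /(_ k (leqnn k))]; exists k.
have gX := cvg_dist_Rintegral XY mX mY (cg k) (bg k).
near=> n; rewrite sub0r normrN ger0_norm ?fine_ge0 //.
apply: le_lt_trans (_ : \int[P]_w g k (X n w) < d); last first.
  by near: n; exact: (cvgr_lt _ gX).
rewrite -Rintegral_indic //; apply: le_bounded_Rintegral => // w.
rewrite indicE; case: (boolP (w \in _)) => //; rewrite inE /= => cw.
(* The cutoff [g k] reaches the value 1 at norm [k + 1]. *)
have ck : k%:R + 1 <= c n by near: n; exact: (cvgryPge _).1.
rewrite /g /ramp divr1 le_min lexx /= le_max; apply/orP; right.
by rewrite lerBrDr addrC (le_trans ck).
Unshelve. all: by end_near. Qed.

End cvg_dist.

(** * Hyperplanes are null sets *)

Section lebesgue_null.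
Variables (R : realType) (k : nat).
Implicit Types (S : set 'cV[R]_k).

Lemma box_vol_ge0 (a b : 'cV[R]_k) : (forall i, a i 0 <= b i 0) -> 0 <= box_vol a b.
Proof. by move=> ab; apply: prodr_ge0 => i _; rewrite subr_ge0. Qed.

Lemma finite_box_cover (I : finType) (lo hi : I -> 'cV[R]_k) (S : set 'cV[R]_k) :
  (0 < k)%N -> (forall f i, lo f i 0 <= hi f i 0) ->
  (forall v, S v -> exists f, in_box (lo f) (hi f) v) ->
  exists a b : nat -> 'cV[R]_k,
    (forall n i, a n i 0 <= b n i 0) /\
    S `<=` \bigcup_n [set v | in_box (a n) (b n) v] /\
    (forall n, \sum_(j < n) box_vol (a j) (b j) <= \sum_f box_vol (lo f) (hi f)).
Proof.
move=> k0 lohi cover.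
(* The finite family is continued by the box reduced to the origin, whose volume is 0 because
   [0 < k] (an empty product would be 1). *)
pose ext (F : I -> 'cV[R]_k) (n : nat) : 'cV[R]_k :=
  if insub n is Some o then F (enum_val (o : 'I_#|I|)) else 0.
have extE F (o : 'I_#|I|) : ext F o = F (enum_val o) by rewrite /ext valK.
exists (ext lo), (ext hi).
have le_ext n i : ext lo n i 0 <= ext hi n i 0.
  by rewrite /ext; case: insub => [u|]; rewrite ?lohi.
split=> //; split.
  move=> v /cover[f fv]; exists (enum_rank f : nat) => //=.
  by rewrite !extE enum_rankK.
move=> n; pose g j := box_vol (ext lo j) (ext hi j).
have g0 j : 0 <= g j by apply: box_vol_ge0.
apply: le_trans (_ : \sum_(j < #|I| + n) g j <= _).
  rewrite -(big_mkord xpredT g) -(big_mkord xpredT g) [X in _ <= X](@big_cat_nat _ _ _ n) //=; last first.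
    exact: leq_addl.
  by rewrite lerDl sumr_ge0.
rewrite big_split_ord /= [X in _ + X]big1 ?addr0; last first.
  move=> j _; rewrite /g /ext insubF; last by rewrite -ltnS ltnNge /= ltnS leq_addr.
  rewrite /box_vol (bigD1 (Ordinal k0)) //= subrr mul0r //.
rewrite (reindex_onto (enum_val : 'I_#|I| -> I) enum_rank) /=; last first.
  by move=> f _; rewrite enum_rankK.
rewrite le_eqVlt; apply/orP; left; apply/eqP.
apply: eq_big => [u|u _]; first by rewrite enum_valK eqxx.
by rewrite /g !extE.
Qed.

Lemma unit_grid (q : nat) (y : R) : 0 <= y <= q.+1%:R ->
  exists j : 'I_q.+1, j%:R <= y <= j%:R + 1.
Proof.
elim: q => [|q IH] /andP[y0 yq]; first by exists ord0; rewrite y0 add0r.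
case: (leP y q.+1%:R) => h.
  have [|j jy] := IH; first by rewrite y0.
  by exists (widen_ord (leqnSn _) j).
by exists ord_max; rewrite (ltW h) /= natr1.
Qed.

(** The hyperplane is a graph over the coordinates other than [i0]. Over a grid cell of side [s]
    this graph varies by at most [rho = L * s], so the boxes above all cells have total volume
    [2 * rho * D], which is [4 * L * M * D / (q + 1)]. *)
Lemma hyperplane_slab_null (a : 'I_k -> R) (i0 : 'I_k) (M : R) :
  a i0 != 0 -> 0 < M ->
  lebesgue_null [set v : 'cV[R]_k | \sum_i a i * v i 0 = 0 /\ forall i, `|v i 0| <= M].
Proof.
move=> ai0 M0 e e0.
pose L := \sum_(i | i != i0) `|a i / a i0|.
have L0 : 0 <= L by apply: sumr_ge0.
pose D := \prod_(i : 'I_k | i != i0) (2 * M).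
have D0 : 0 <= D by apply: prodr_ge0 => i _; rewrite mulr_ge0 // ltW.
have [q qe] : exists q : nat, 4 * L * M * D / e <= q.+1%:R.
  exists (Num.truncn (4 * L * M * D / e)); apply: ltW; exact: truncnS_gt.
pose s : R := 2 * M / q.+1%:R.
have s0 : 0 < s by rewrite divr_gt0 // mulr_gt0.
pose rho := L * s.
have rho0 : 0 <= rho by rewrite mulr_ge0 // ltW.
pose base (f : {ffun 'I_k -> 'I_q.+1}) i : R := - M + s * (f i)%:R.
pose ctr f := - \sum_(i | i != i0) a i / a i0 * base f i.
(* Cells are indexed by functions on all coordinates so that the sum of volumes factors as a
   product. The value at [i0] is redundant; the boxes with [f i0 != ord0] are flattened to volume 0,
   which avoids counting each cell [q + 1] times. *)
pose half (f : {ffun 'I_k -> 'I_q.+1}) : R := if f i0 == ord0 then rho else 0.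
pose lo f : 'cV[R]_k := \col_i if i == i0 then ctr f - half f else base f i.
pose hi f : 'cV[R]_k := \col_i if i == i0 then ctr f + half f else base f i + s.
have half0 f : 0 <= half f by rewrite /half; case: eqP.
have k0 : (0 < k)%N by apply: leq_trans (ltn_ord i0).
have lohi f i : lo f i 0 <= hi f i 0.
  rewrite !mxE; case: eqP => _; last by rewrite lerDl ltW.
  by apply: lerD => //; have := half0 f; lra.
have [|A [B [AB [SAB volAB]]]] := @finite_box_cover _ lo hi
  [set v : 'cV[R]_k | \sum_i a i * v i 0 = 0 /\ forall i, `|v i 0| <= M] k0 lohi.
  move=> v [av vM].
  have grid i : exists j : 'I_q.+1, (- M + s * j%:R <= v i 0 <= - M + s * j%:R + s).
    have /andP[v1 v2] : - M <= v i 0 <= M by rewrite -ler_norml vM.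
    have [|j /andP[j1 j2]] := @unit_grid q ((v i 0 + M) / s).
      rewrite divr_ge0 ?(ltW s0) //=; last by lra.
      rewrite ler_pdivrMr // /s mulrCA mulfV ?mulr1; last by rewrite pnatr_eq0.
      by lra.
    exists j; move: j1 j2; rewrite ler_pdivlMr // ler_pdivrMr // mulrDl mul1r mulrC.
    by move=> *; apply/andP; split; lra.
  pose f : {ffun 'I_k -> 'I_q.+1} := [ffun i => if i == i0 then ord0 else xchoose (grid i)].
  have fP i : i != i0 -> base f i <= v i 0 <= base f i + s.
    by move=> ii0; rewrite /base ffunE (negbTE ii0); exact: (xchooseP (grid i)).
  exists f => i; rewrite !mxE; case: (eqVneq i i0) => [->|]; last exact: fP.
  rewrite /half ffunE eqxx.
  have vE : v i0 0 - ctr f = - \sum_(i | i != i0) a i / a i0 * (v i 0 - base f i).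
    move: av; rewrite (bigD1 i0) //= => /eqP; rewrite addr_eq0 => /eqP av.
    have -> : v i0 0 = - \sum_(i | i != i0) a i / a i0 * v i 0.
      apply: (mulfI ai0); rewrite av mulrN mulr_sumr; congr (- _).
      by apply: eq_bigr => l _; rewrite mulrA mulrCA mulfV // mulr1.
    rewrite [in RHS](eq_bigr (fun i => a i / a i0 * v i 0 - a i / a i0 * base f i)); last first.
      by move=> l _; rewrite mulrBr.
    by rewrite /ctr opprK sumrB opprB addrC.
  have : `|v i0 0 - ctr f| <= rho.
    rewrite vE normrN /rho /L mulr_suml; apply: le_trans (ler_norm_sum _ _ _) _.
    apply: ler_sum => l li0; rewrite normrM ler_wpM2l //.
    by have /andP[? ?] := fP l li0; rewrite ger0_norm; lra.
  by rewrite ler_norml /= => /andP[h1 h2]; apply/andP; split; lra.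
exists A, B; split=> //; split=> // n; apply: le_trans (volAB n) _.
pose g (i : 'I_k) (j : 'I_q.+1) : R :=
  if i == i0 then (if j == ord0 then rho + rho else 0) else s.
have -> : \sum_f box_vol (lo f) (hi f) = \prod_i \sum_j g i j.
  rewrite bigA_distr_bigA /=; apply: eq_bigr => f _; apply: eq_bigr => i _.
  rewrite !mxE /g; case: eqP => [->|_]; last by rewrite addrC addKr.
  by rewrite /half; case: eqP => _; ring.
rewrite (bigD1 i0) //= /g eqxx (bigD1 ord0) //= big1 ?addr0; last first.
  by move=> j /negbTE ->.
rewrite (_ : \prod_(i | i != i0) _ = D); last first.
  apply: eq_bigr => i /negbTE ->; rewrite sumr_const card_ord -[LHS]mulr_natr /s.
  by rewrite divfK // pnatr_eq0.
rewrite /rho /s; move: qe; rewrite ler_pdivrMr // [X in _ <= X]mulrC -ler_pdivrMr ?ltr0n // => qe.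
apply: le_trans qe; rewrite le_eqVlt; apply/orP; left; apply/eqP; ring.
Qed.

End lebesgue_null.

Lemma mulmx_coord_continuous (R : realType) k l (B : 'M[R]_(l, k)) j :
  continuous (fun v : 'cV[R]_k => (B *m v) j 0).
Proof.
move=> v; have -> : (fun v : 'cV[R]_k => (B *m v) j 0) = (fun v => \sum_i B j i * v i 0).
  by apply/funext => x; rewrite mxE.
have H i : (fun x : 'cV[R]_k => B j i * x i 0) @ nbhs v --> B j i * v i 0.
  by apply: cvgMl_tmp; exact: coord_continuous.
exact: (@cvg_sum_fin _ _ (nbhs v) _ _ _ _ _ H).
Qed.

Lemma coord_le_norm (R : realType) k l (v : 'M[R]_(k, l)) i j : `|v i j| <= `|v|.
Proof.
rewrite [X in _ <= X](mx_normrE v).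
exact: (le_bigmax _ (fun ij => `|v ij.1 ij.2|) (i, j)).
Qed.

Lemma law_abs_cont_hyperplane (R : realType) (dT : measure_display)
  (T : measurableType dT) (P : probability T R) (k : nat) (Z : T -> 'cV[R]_k)
  (a : 'rV[R]_k) (i0 : 'I_k) :
  law_abs_cont P Z -> rand_cV Z -> a 0 i0 != 0 ->
  P [set w | (a *m Z w) 0 0 = 0] = 0%E.
Proof.
move=> acZ mZ ai0.
have oZ : open_measurable_map Z.
  by apply: open_measurable_matrix => i j; rewrite (ord1 j); exact: mZ.
have m0 : measurable [set w | (a *m Z w) 0 0 = 0].
  have := measurable_continuous_comp oZ (mulmx_coord_continuous (B := a) (j := 0))
    measurableT (measurable_set1 (0:R)).
  by rewrite setTI.
(* Finite covers exist only for bounded pieces of the hyperplane; countably many such pieces exhaust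
   it. *)
pose S (n : nat) : set 'cV[R]_k := [set v | (a *m v) 0 0 = 0 /\ `|v| <= n.+1%:R].
apply/negligibleP => //.
have -> : [set w | (a *m Z w) 0 0 = 0] = \bigcup_n (Z @^-1` S n).
  apply/seteqP; split => [w aw|w [n _ []] //].
  exists (Num.truncn `|Z w|) => //; split=> //; apply: ltW; exact: truncnS_gt.
apply: negligible_bigcup => n; apply/negligibleP.
  have -> : Z @^-1` S n = [set w | (a *m Z w) 0 0 = 0] `&` [set w | `|Z w| <= n.+1%:R] by [].
  apply: measurableI => //.
  have := measurable_continuous_comp oZ (@norm_continuous _ _) measurableT
    (measurable_itv `]-oo, n.+1%:R]).
  by rewrite setTI; congr measurable; apply/seteqP; split => w /=; rewrite in_itv.
apply: acZ.
  move=> e e0; have [A [B [AB [SAB vol]]]] := hyperplane_slab_null ai0 (@ltr0Sn R n) e0.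
  exists A, B; split=> //; split=> // v [av vn]; apply: SAB; split.
    by move: av; rewrite mxE.
  by move=> i; apply: le_trans (coord_le_norm _ _ _) vn.
have -> : Z @^-1` S n = [set w | (a *m Z w) 0 0 = 0] `&` [set w | `|Z w| <= n.+1%:R] by [].
apply: measurableI => //.
have := measurable_continuous_comp oZ (@norm_continuous _ _) measurableT
  (measurable_itv `]-oo, n.+1%:R]).
by rewrite setTI; congr measurable; apply/seteqP; split => w /=; rewrite in_itv.
Qed.

(** * The cones and the limit distribution *)

Lemma mx_continuous (R : realType) (V : topologicalType) k l (F : V -> 'M[R]_(k, l)) :
  (forall i j, continuous (fun v => F v i j)) -> continuous F.
Proof.
move=> cF v U [Q Qnb sQ]; apply: (filterS (P := fun x => forall i j, Q i j (F x i j))).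
  by move=> x Qx; exact: sQ.
apply: filter_forall => i; apply: filter_forall => j.
exact: cF (Qnb i j).
Qed.

Lemma continuous_bigmin (R : realType) (V : topologicalType) (I : Type) (s : seq I)
  (Q : pred I) (F : I -> V -> R) :
  (forall i, continuous (F i)) ->
  continuous (fun v => \big[Num.min/1]_(i <- s | Q i) F i v).
Proof.
move=> cF; elim: s => [|i s IH].
  rewrite (_ : (fun v => _) = (fun=> 1)); first by move=> v; exact: cvg_cst.
  by apply/funext => v; rewrite big_nil.
case Qi: (Q i).
  rewrite (_ : (fun v => _) = (fun v => Num.min (F i v) (\big[Num.min/1]_(i <- s | Q i) F i v))).
    by move=> v; apply: (@continuous_min _ _ (F i)); [exact: cF | exact: IH].
  by apply/funext => v; rewrite big_cons Qi.
rewrite (_ : (fun v => _) = (fun v => \big[Num.min/1]_(i <- s | Q i) F i v)) //.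
by apply/funext => v; rewrite big_cons Qi.
Qed.

Lemma bigmin1_eq0 (R : realType) (I : finType) (Q : pred I) (F : I -> R) :
  \big[Num.min/1]_(i | Q i) F i = 0 -> exists2 i, Q i & F i = 0.
Proof.
move=> F0.
have : \big[Num.min/1]_(i | Q i) F i = 1 \/
    exists2 i, Q i & \big[Num.min/1]_(i | Q i) F i = F i.
  elim/big_ind : _ => [|x y Hx Hy|i Qi]; [by left| |by right; exists i].
  by case: (leP x y).
case=> [|[i Qi]]; first by rewrite F0 => /eqP; rewrite eq_sym oner_eq0.
by rewrite F0 => ?; exists i.
Qed.

Section cone_pattern.
Variables (R : realType) (m0 m1 d : nat) (A : 'M[R]_(m0 + m1, d)).
Variables (N K : nat) (Ib : 'I_N -> {set 'I_d}) (xb : 'cV[R]_d).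
Implicit Types (v : 'cV[R]_(m0 + m1)) (k : 'I_N) (KK : {set 'I_N}).
Local Notation Ainv k := (invmx (AI A (Ib k))).

(* Rows vanishing on the random coordinates give the void constraint [0 <= 0];
   they must be discarded because the limit law charges their zero set. *)
Definition active_rows k : {set 'I_(m0 + m1)} :=
  [set j in Jset (m0 + m1) xb (Ib k) | lsubmx (row j (Ainv k)) != 0]%SET.

(** The neutral element 1 makes a cone without active rows the whole space, with a gap that never
    vanishes. The value [-1] encodes that bases beyond [K] are infeasible near [b]. *)
Definition cone_gap k v : R :=
  if (k < K)%N then \big[Num.min/1]_(j in active_rows k) (Ainv k *m v) j 0 else -1.

Definition pattern v : {set 'I_N} := [set k | 0 <= cone_gap k v]%SET.

(** A continuous function whose sign selects a piece: nonnegative for [KK = pattern v], nonpositive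
    for every other [KK]. *)
Definition pattern_gap KK v : R :=
  \big[Num.min/1]_k (if k \in KK then cone_gap k v else - cone_gap k v).

Lemma row_mul_usub v k j : dsubmx v = 0 ->
  (Ainv k *m v) j 0 = (lsubmx (row j (Ainv k)) *m usubmx v) 0 0.
Proof.
move=> v0; rewrite -{1}[v]vsubmxK v0.
rewrite -[Ainv k]hsubmxK mul_row_col mulmx0 addr0 hsubmxK.
by rewrite !mxE; apply: eq_bigr => l _; rewrite !mxE.
Qed.

Lemma Hcone_gapP v k : (k < K)%N -> dsubmx v = 0 ->
  Hcone A xb (Ib k) (usubmx v) <-> 0 <= cone_gap k v.
Proof.
move=> kK v0.
have -> : Hcone A xb (Ib k) (usubmx v) =
    (forall j, j \in Jset (m0 + m1) xb (Ib k) -> 0 <= (Ainv k *m v) j 0).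
  by rewrite /Hcone /= -v0 vsubmxK.
rewrite /cone_gap kK; split => [H|/Order.TotalTheory.bigmin_geP[_ H] j jJ].
  apply/Order.TotalTheory.bigmin_geP; split => // j; rewrite inE => /andP[jJ _].
  exact: H.
(* A discarded row meets only the last [m1] coordinates of [v], which are zero. *)
case: (eqVneq (lsubmx (row j (Ainv k))) 0) => j0.
  by rewrite row_mul_usub // j0 mul0mx mxE.
by apply: H; rewrite inE jJ.
Qed.

Lemma pattern_lt v k : k \in pattern v -> (k < K)%N.
Proof. by rewrite inE /cone_gap; case: ifP => // _; rewrite oppr_ge0 ler10. Qed.

Lemma pattern_gap_ge0 v : 0 <= pattern_gap (pattern v) v.
Proof.
apply/Order.TotalTheory.bigmin_geP; split => // k _; rewrite inE.
by case: ifPn => //; rewrite -ltNge oppr_ge0 => /ltW.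
Qed.

Lemma pattern_gap_le0 KK v : KK != pattern v -> pattern_gap KK v <= 0.
Proof.
apply: contraNT; rewrite -ltNge => gt0.
have /Order.TotalTheory.bigmin_geP[_ H] := lexx (pattern_gap KK v).
apply/eqP/setP => k; rewrite inE; have := lt_le_trans gt0 (H k isT).
case: (k \in KK) => [/ltW ->//|]; rewrite oppr_gt0 => h.
by rewrite leNgt h.
Qed.

(** The boundary between pieces lies in finitely many hyperplanes of the random coordinates, each
    with a nonzero normal vector. *)
Lemma pattern_gap_eq0 KK v : dsubmx v = 0 -> pattern_gap KK v = 0 ->
  exists k j, lsubmx (row j (Ainv k)) != 0 /\ (lsubmx (row j (Ainv k)) *m usubmx v) 0 0 = 0.
Proof.
move=> v0 /bigmin1_eq0[k _ gk].
have {}gk : cone_gap k v = 0.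
  by move: gk; case: ifP => // _ /eqP; rewrite oppr_eq0 => /eqP.
move: gk; rewrite /cone_gap; case: ifP => [_ /bigmin1_eq0[j]|_ /eqP].
  by rewrite inE => /andP[_ j0]; rewrite row_mul_usub // => ?; exists k, j.
by rewrite oppr_eq0 oner_eq0.
Qed.

Lemma cone_gap_continuous k : continuous (cone_gap k).
Proof.
rewrite /cone_gap; case: (k < K)%N; last exact: cst_continuous.
by apply: continuous_bigmin => j; exact: mulmx_coord_continuous.
Qed.

Lemma pattern_gap_continuous KK : continuous (pattern_gap KK).
Proof.
apply: continuous_bigmin => k; case: (k \in KK); first exact: cone_gap_continuous.
by move=> v; exact: (continuousN (@cone_gap_continuous k v)).
Qed.

Lemma otimes_continuous KK :
  continuous (fun p : 'rV[R]_N * 'cV[R]_(m0 + m1) => otimes A Ib KK p.1 p.2).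
Proof.
apply: mx_continuous => i z p; rewrite (ord1 z).
have -> : (fun p : 'rV[R]_N * 'cV[R]_(m0 + m1) => otimes A Ib KK p.1 p.2 i 0) =
  (fun p => \sum_(k in KK) p.1 0 k * xB A (Ib k) p.2 i 0).
  by apply/funext => q; rewrite /otimes summxE; apply: eq_bigr => k _; rewrite mxE.
have H k : (fun p : 'rV[R]_N * 'cV[R]_(m0 + m1) => p.1 0 k * xB A (Ib k) p.2 i 0) @ nbhs p
    --> p.1 0 k * xB A (Ib k) p.2 i 0.
  apply: cvgM.
    apply: (@continuous_comp _ _ _ fst (fun a : 'rV[R]_N => a 0 k)).
      exact: cvg_fst.
    exact: coord_continuous.
  apply: (@continuous_comp _ _ _ snd (fun v : 'cV[R]_(m0 + m1) => xB A (Ib k) v i 0)).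
    exact: cvg_snd.
  have -> : (fun v : 'cV[R]_(m0 + m1) => xB A (Ib k) v i 0) =
     (fun v => (selmx R (m0 + m1) (Ib k) *m Ainv k *m v) i 0).
    by apply/funext => v; rewrite -mulmxA.
  exact: mulmx_coord_continuous.
have HS := @cvg_sum_fin _ _ (nbhs p) _ _ (enum KK) _ _ H.
rewrite (_ : (fun q : _ * _ => _) = (fun q : 'rV[R]_N * 'cV[R]_(m0 + m1) => \sum_(k <- enum KK) q.1 0 k * xB A (Ib k) q.2 i 0)); last first.
  by apply/funext => q; rewrite big_enum.
by apply: HS; exact: nbhs_filter.
Qed.

End cone_pattern.

(** Finitely many linear, hence continuous, coordinates keep their strict sign near [b]; only those
    vanishing at [b] remain undecided. *)
Lemma xB_sign_stable (R : realType) (m d N : nat) (A : 'M[R]_(m, d))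
  (Ib : 'I_N -> {set 'I_d}) (b : 'cV[R]_m) :
  exists2 e : R, 0 < e & forall beta : 'cV[R]_m, `|beta - b| < e -> forall k i,
    (xB A (Ib k) b i 0 < 0 -> xB A (Ib k) beta i 0 < 0) /\
    (0 < xB A (Ib k) b i 0 -> 0 < xB A (Ib k) beta i 0).
Proof.
have cx k i : continuous (fun v : 'cV[R]_m => xB A (Ib k) v i 0).
  have -> : (fun v : 'cV[R]_m => xB A (Ib k) v i 0) =
     (fun v => (selmx R m (Ib k) *m invmx (AI A (Ib k)) *m v) i 0).
    by apply/funext => v; rewrite -mulmxA.
  exact: mulmx_coord_continuous.
have : \forall beta \near nbhs b, forall k, forall i,
    (xB A (Ib k) b i 0 < 0 -> xB A (Ib k) beta i 0 < 0) /\
    (0 < xB A (Ib k) b i 0 -> 0 < xB A (Ib k) beta i 0).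
  apply: filter_forall => k; apply: filter_forall => i; apply: filterI.
    case: (boolP (xB A (Ib k) b i 0 < 0)) => h; last exact: (@nearW _ (nbhs b)).
    apply: (@filterS _ (nbhs b) _ _ _ _ (cvgr_lt _ (cx k i b) _ h)).
    by move=> beta.
  case: (boolP (0 < xB A (Ib k) b i 0)) => h; last exact: (@nearW _ (nbhs b)).
  apply: (@filterS _ (nbhs b) _ _ _ _ (cvgr_gt _ (cx k i b) _ h)).
  by move=> beta.
move=> /nbhs_ballP[e /= e0 eP]; exists e => // beta be; apply: eP.
by rewrite mx_norm_ball /ball_ /= distrC.
Qed.

(** * Feasible bases near [b] and the rescaled solution in terms of cones *)

Section optimal_pattern.
Variables (R : realType) (m0 m1 d : nat) (A : 'M[R]_(m0 + m1, d)) (b : 'cV[R]_(m0 + m1)).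
Variables (N K : nat) (Ib : 'I_N -> {set 'I_d}) (xb : 'cV[R]_d).
Hypothesis basisIb : forall k, is_basis A (Ib k).
Hypothesis hIbK : forall k : 'I_N, (k < K)%N <-> nonneg_vec (xB A (Ib k) b).
Hypothesis xb_basic : forall k : 'I_N, (k < K)%N -> xB A (Ib k) b = xb.
Hypothesis xb_ge0 : nonneg_vec xb.

(** Where [xb] vanishes, the coordinate at [b + s *: g] is [s] times the one at [g], so its sign is
    a condition on [g] alone; elsewhere stability decides. *)
Lemma nonneg_patternP (s : R) (g : 'cV[R]_(m0 + m1)) (k : 'I_N) : 0 < s -> dsubmx g = 0 ->
  (forall k i, (xB A (Ib k) b i 0 < 0 -> xB A (Ib k) (b + s *: g) i 0 < 0) /\
    (0 < xB A (Ib k) b i 0 -> 0 < xB A (Ib k) (b + s *: g) i 0)) ->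
  nonneg_vec (xB A (Ib k) (b + s *: g)) <-> k \in pattern A K Ib xb g.
Proof.
move=> s0 g0 stable; split => [xpos|kS].
  have kK : (k < K)%N.
    apply/hIbK => i; rewrite leNgt; apply/negP => /(stable k i).1.
    by rewrite ltNge xpos.
  rewrite inE; apply/Hcone_gapP => // j; rewrite inE => /existsP[i /and3P[iI /eqP ij iP]].
  have xi : xb i 0 = 0.
    by apply/eqP; rewrite eq_le xb_ge0 andbT leNgt; move: iP; rewrite inE.
  have := xpos i; rewrite xBD xBZ xb_basic // mxE xi add0r mxE pmulr_rge0 //.
  by rewrite /xB (selmxE _ iI ij) -g0 vsubmxK.
have kK := pattern_lt kS.
move: kS; rewrite inE => /(Hcone_gapP A Ib xb kK g0) gH i.
case: (boolP (i \in Ib k)) => iI; last by rewrite xB_out.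
case: (boolP (i \in Pos xb)) => iP.
  by apply/ltW/(stable k i).2; rewrite xb_basic //; move: iP; rewrite inE.
have lti : (rank_in (Ib k) i < m0 + m1)%N.
  by have [Im _] := basisIb k; rewrite -[X in (_ < X)%N]Im rank_in_lt.
rewrite xBD xBZ xb_basic // mxE addr_ge0 // mxE pmulr_rge0 //.
rewrite /xB (selmxE (j := Ordinal lti) _ iI) //.
have := gH (Ordinal lti); rewrite -g0 vsubmxK; apply.
by rewrite inE; apply/existsP; exists i; rewrite iI eqxx iP.
Qed.

(** All bases in [KK] give the same [xb] at [b] and the weights sum to 1, so [xb] cancels whatever
    the weights are. *)
Lemma otimes_rescale (s : R) (g : 'cV[R]_(m0 + m1)) (KK : {set 'I_N}) (a : 'rV[R]_N) :
  s != 0 -> (forall k, k \in KK -> (k < K)%N) -> in_simplex KK a ->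
  s *: (otimes A Ib KK a (b + s^-1 *: g) - xb) = otimes A Ib KK a g.
Proof.
move=> s0 KKK [a0 [aout a1]].
have E : otimes A Ib KK a (b + s^-1 *: g) = xb + s^-1 *: otimes A Ib KK a g.
  have a1' : \sum_(k in KK) a 0 k = 1.
    by rewrite -a1 [RHS](bigID (mem KK)) /= [X in _ + X]big1 ?addr0.
  rewrite /otimes scaler_sumr -[xb in RHS]scale1r -a1' scaler_suml -big_split /=.
  apply: eq_bigr => k kKK; rewrite xBD xBZ xb_basic ?KKK // scalerDr.
  by rewrite !scalerA mulrC.
by rewrite E addrC addKr scalerA mulfV // scale1r.
Qed.

Definition piecewise_limit (a : {set 'I_N} -> 'rV[R]_N) (g : 'cV[R]_(m0 + m1)) : 'cV[R]_d :=
  \sum_(KK : {set 'I_N} | (KK != finset.set0) && [forall k in KK, (k < K)%N])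
    \1_((\bigcap_(k in [set k : 'I_N | k \in KK]) Hcone A xb (Ib k))
        `\` (\bigcup_(k in [set k : 'I_N | (k < K)%N /\ k \notin KK])
               Hcone A xb (Ib k))) (usubmx g)
    *: otimes A Ib KK (a KK) g.

Lemma piecewise_limitE a g : dsubmx g = 0 ->
  piecewise_limit a g = otimes A Ib (pattern A K Ib xb g) (a (pattern A K Ib xb g)) g.
Proof.
move=> g0; set S := pattern A K Ib xb g.
have indicE' (KK : {set 'I_N}) : [forall k in KK, (k < K)%N] ->
   ((\bigcap_(k in [set k : 'I_N | k \in KK]) Hcone A xb (Ib k))
        `\` (\bigcup_(k in [set k : 'I_N | (k < K)%N /\ k \notin KK])
               Hcone A xb (Ib k))) (usubmx g) <-> KK = S.
  move=> /forall_inP KKK; split.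
    move=> [inH outH]; apply/setP => k; apply/idP/idP => kS.
      by rewrite inE; apply/Hcone_gapP => //; [exact: KKK | exact: inH].
    apply: contraPT kS => kKK kS; apply: outH; exists k.
      by split => //; exact: pattern_lt kS.
    apply/(Hcone_gapP A Ib xb (pattern_lt kS) g0).
    by move: kS; rewrite inE.
  move=> ->; split.
    move=> k /= kS; apply/(Hcone_gapP A Ib xb (pattern_lt kS) g0).
    by move: kS; rewrite inE.
  move=> [k [kK kS]] /(Hcone_gapP A Ib xb kK g0) gk.
  by move: kS; rewrite inE gk.
have SK : [forall k in S, (k < K)%N] by apply/forall_inP => k; exact: pattern_lt.
have off (KK : {set 'I_N}) : [forall k in KK, (k < K)%N] -> KK != S ->
   \1_((\bigcap_(k in [set k : 'I_N | k \in KK]) Hcone A xb (Ib k))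
        `\` (\bigcup_(k in [set k : 'I_N | (k < K)%N /\ k \notin KK])
               Hcone A xb (Ib k))) (usubmx g)
    *: otimes A Ib KK (a KK) g = 0.
  move=> KKK KKS; rewrite indicE memNset ?scale0r // => /(indicE' _ KKK) KE.
  by rewrite KE eqxx in KKS.
(* The sum omits the empty set; if no cone contains [g], both sides are zero. *)
rewrite /piecewise_limit; case: (eqVneq S finset.set0) => S0.
  rewrite S0 /otimes [RHS]big_pred0; last by move=> k; rewrite inE.
  apply: big1 => KK /andP[KK0 KKK]; apply: off => //.
  by rewrite S0.
rewrite (bigD1 S) ?S0 //= indicE mem_set ?scale1r; last exact/indicE'.
rewrite big1 ?addr0 // => KK /andP[/andP[_ KKK] KKS].
exact: off.
Qed.

End optimal_pattern.

Lemma open_measurable_fin_select (dT : measure_display) (T : measurableType dT)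
  (V : topologicalType) (I : finType) (s : T -> I) (F : I -> T -> V) :
  (forall i, measurable [set w | s w = i]) -> (forall i, open_measurable_map (F i)) ->
  open_measurable_map (fun w => F (s w) w).
Proof.
move=> ms mF U oU.
rewrite (_ : _ @^-1` U = \bigcup_i ([set w | s w = i] `&` F i @^-1` U)).
  apply: countable_bigcupT_measurable => [|i]; first exact: countableP.
  by apply: measurableI => //; exact: mF.
by apply/seteqP; split => [w Uw|w [i _ [<-]] //]; exists (s w).
Qed.

Lemma otimes_set0 (R : realType) (m d N : nat) (A : 'M[R]_(m, d))
  (Ib : 'I_N -> {set 'I_d}) (a : 'rV[R]_N) (v : 'cV[R]_m) :
  otimes A Ib finset.set0 a v = 0.
Proof. by apply: big_pred0 => k; rewrite inE. Qed.

Theorem theorem3p1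
  (R : realType) (m0 m1 d : nat)
  (A : 'M[R]_(m0 + m1, d)) (b : 'cV[R]_(m0 + m1)) (c : 'cV[R]_d)
  (hm0 : (0 < m0)%N) (hrank : \rank A = (m0 + m1)%N)
  (* I_1, ..., I_N : all dual feasible bases; I_1..I_K those with x(I_k,b) >= 0 *)
  (N K : nat) (Ib : 'I_N -> {set 'I_d})
  (hIb_inj : injective Ib)
  (hIb_df : forall k, dual_feasible_basis A c (Ib k))
  (hIb_all : forall I, dual_feasible_basis A c I -> exists k, Ib k = I)
  (hKN : (K <= N)%N)
  (hIbK : forall k : 'I_N, (k < K)%N <-> nonneg_vec (xB A (Ib k) b))
  (* (A2) *)
  (xb : 'cV[R]_d)
  (hA2 : optimal A c b xb /\ forall y, optimal A c b y -> y = xb)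
  (* stochastic setting *)
  (dT : measure_display) (T : measurableType dT) (P : probability T R)
  (r : nat -> R) (hr_pos : forall n, 0 < r n) (hr : r @ \oo --> +oo)
  (bn : nat -> T -> 'cV[R]_(m0 + m1))
  (hbn_meas : forall n, rand_cV (bn n))
  (hbn_fix : forall n w, dsubmx (bn n w) = dsubmx b)
  (dT' : measure_display) (T' : measurableType dT') (P' : probability T' R)
  (G : T' -> 'cV[R]_(m0 + m1)) (hG_meas : rand_cV G)
  (hG0 : forall w, dsubmx (G w) = 0)
  (hGac : law_abs_cont P' (fun w => usubmx (G w)))
  (* (B1) *)
  (hB1 : cvg_dist P (fun n w => r n *: (bn n w - b)) P' G)
  (* (B2) *)
  (hB2 : (fun n => P [set w | has_optimal A c (bn n w)]) @ \oo --> 1%E)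
  (* measurable choice of an optimal solution x*(b_n) *)
  (xs : nat -> T -> 'cV[R]_d) (hxs_meas : forall n, rand_cV (xs n))
  (hxs_opt : forall n w, has_optimal A c (bn n w) -> optimal A c (bn n w) (xs n w))
  (* weights alpha_n^KK *)
  (alphan : {set 'I_N} -> nat -> T -> 'rV[R]_N)
  (halphan_meas : forall KK n, rand_rV (alphan KK n))
  (halphan_simp : forall KK n w, KK != finset.set0 -> in_simplex KK (alphan KK n w))
  (halphan_rep : forall KK n w, KK != finset.set0 ->
     (forall k, nonneg_vec (xB A (Ib k) (bn n w)) <-> k \in KK) ->
     xs n w = otimes A Ib KK (alphan KK n w) (bn n w))
  (* limits (alpha^KK, G) *)
  (alpha : {set 'I_N} -> T' -> 'rV[R]_N)
  (halpha_meas : forall KK, rand_rV (alpha KK))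
  (halpha_simp : forall KK w, KK != finset.set0 -> in_simplex KK (alpha KK w))
  (hconv : forall KK, KK != finset.set0 ->
     cvg_dist P (fun n w => (alphan KK n w, r n *: (bn n w - b)))
              P' (fun w => (alpha KK w, G w))) :
  cvg_dist P (fun n w => r n *: (xs n w - xb)) P'
    (fun w => \sum_(KK : {set 'I_N} | (KK != finset.set0) && [forall k in KK, (k < K)%N])
       \1_((\bigcap_(k in [set k : 'I_N | k \in KK]) Hcone A xb (Ib k))
           `\` (\bigcup_(k in [set k : 'I_N | (k < K)%N /\ k \notin KK])
                  Hcone A xb (Ib k))) (usubmx (G w))
       *: otimes A Ib KK (alpha KK w) (G w))
  /\
  (nondeg_basic_sol (m0 + m1) xb ->
     K = 1%N /\
     forall k1 : 'I_N, val k1 = 0%N ->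
       cvg_dist P (fun n w => r n *: (xs n w - xb)) P' (fun w => xB A (Ib k1) (G w))).

Proof.
have [xopt xuniq] := hA2.
have xb_ge0 : nonneg_vec xb := xopt.1.2.
have basisIb k : is_basis A (Ib k) := (hIb_df k).1.
have xb_basic (k : 'I_N) : (k < K)%N -> xB A (Ib k) b = xb.
  by move=> /hIbK h; apply: xuniq; apply: weak_duality.
(* Solvability becomes finitely many linear inequalities, which makes the event in [hB2] measurable
   and the pattern nonempty on it. *)
have optP beta : has_optimal A c beta <-> exists k, nonneg_vec (xB A (Ib k) beta).
  split => [/(has_optimal_basis hrank)[I Idf I0]|[k k0]].
    by have [k kI] := hIb_all _ Idf; exists k; rewrite kI.
  by exists (xB A (Ib k) beta); exact: weak_duality.
have r0 n : r n != 0 by rewrite gt_eqF.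
pose Gn n w := r n *: (bn n w - b).
have bnE n w : bn n w = b + (r n)^-1 *: Gn n w.
  by rewrite /Gn scalerA mulVf // scale1r addrC subrK.
have Gn0 n w : dsubmx (Gn n w) = 0.
  apply/matrixP => i j; have /matrixP/(_ i j) := hbn_fix n w.
  by rewrite !mxE => ->; rewrite subrr mulr0.
have mGnc n i j : measurable_fun setT (fun w => Gn n w i j).
  rewrite (_ : (fun w => _) = (fun w => r n * (bn n w i 0 - b i 0))).
    by apply: measurable_funM => //; apply: measurable_funB => //; exact: hbn_meas.
  by apply/funext => w; rewrite (ord1 j) !mxE.
have mGc i j : measurable_fun setT (fun w => G w i j) by rewrite (ord1 j); exact: hG_meas.
have mG : open_measurable_map G by exact: open_measurable_matrix.
have mGn n : open_measurable_map (Gn n) by exact: open_measurable_matrix.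
(* [hconv] covers nonempty sets only. With zero weights at the empty set, convergence there reduces
   to [hB1], and all sets can be treated as pieces. *)
pose an KK n w : 'rV[R]_N := if KK == finset.set0 then 0 else alphan KK n w.
pose a KK w : 'rV[R]_N := if KK == finset.set0 then 0 else alpha KK w.
have manc KK n i j : measurable_fun setT (fun w => an KK n w i j).
  rewrite /an; case: (eqVneq KK finset.set0) => _; last by rewrite (ord1 i); exact: halphan_meas.
  by apply: measurable_cst.
have mac KK i j : measurable_fun setT (fun w => a KK w i j).
  rewrite /a; case: (eqVneq KK finset.set0) => _; last by rewrite (ord1 i); exact: halpha_meas.
  by apply: measurable_cst.
pose Z KK n w := (an KK n w, Gn n w).
pose Z' KK w := (a KK w, G w).
have mZ KK n : open_measurable_map (Z KK n) by exact: open_measurable_matrix_pair.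
have mZ' KK : open_measurable_map (Z' KK) by exact: open_measurable_matrix_pair.
have ZZ' KK : cvg_dist P (Z KK) P' (Z' KK).
  rewrite /Z /Z' /an /a; case: (eqVneq KK finset.set0) => KK0; last exact: hconv.
  move=> f cf bf; apply: (hB1 (fun v => f (0, v))).
    move=> v; apply: (@continuous_comp _ _ _ (fun v : 'cV[R]_(m0 + m1) => (0 : 'rV[R]_N, v)) f).
      apply: (@cvg_pair _ _ _ (nbhs v) (nbhs (0 : 'rV[R]_N)) (nbhs v) _ _ _ (fun=> 0) id).
        exact: cvg_cst.
      exact: cvg_id.
    exact: cf.
  by have [M fM] := bf; exists M.
have mpat KK : measurable [set w | pattern A K Ib xb (G w) = KK].
  rewrite (_ : [set w | _] = \bigcap_(k in [set: 'I_N])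
      [set w | (0 <= cone_gap A K Ib xb k (G w)) = (k \in KK)]).
    apply: fin_bigcap_measurable => [|k _]; first exact: finite_finset.
    have mk := measurable_continuous_comp mG (@cone_gap_continuous _ _ _ _ A N K Ib xb k).
    have mk0 : measurable [set w | 0 <= cone_gap A K Ib xb k (G w)].
      have := mk measurableT _ (measurable_itv `[0, +oo[).
      rewrite setTI; congr measurable; apply/seteqP.
      by split => w /=; rewrite in_itv /= andbT.
    case: (k \in KK).
      by rewrite (_ : [set w | _] = [set w | 0 <= cone_gap A K Ib xb k (G w)]).
    rewrite (_ : [set w | _] = ~` [set w | 0 <= cone_gap A K Ib xb k (G w)]).
      exact: measurableC.
    by apply/seteqP; split => w /=; [move=> -> | move/negP/negbTE].
  apply/seteqP; split => [w /= <- k _ /=|w H /=]; first by rewrite inE.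
  by apply/setP => k; rewrite inE; exact: H.
have YE w : piecewise_limit A K Ib xb (fun KK => alpha KK w) (G w) =
    otimes A Ib (pattern A K Ib xb (G w)) (Z' (pattern A K Ib xb (G w)) w).1
      (Z' (pattern A K Ib xb (G w)) w).2.
  rewrite piecewise_limitE // /Z' /a /=; case: eqVneq => // ->.
  by rewrite !otimes_set0.
have [e e0 stable] := xB_sign_stable A Ib b.
pose Bs n := [set w | has_optimal A c (bn n w)].
(* Equivalently [bn n w] is within [e] of [b]; tightness of [Gn] makes this event likely. *)
pose Bt n := [set w | `|Gn n w| < e * r n].
have mBs n : measurable (Bs n).
  have mbn : open_measurable_map (bn n).
    by apply: open_measurable_matrix => i j; rewrite (ord1 j); exact: hbn_meas.
  rewrite (_ : Bs n = \bigcup_k (\bigcap_(i in [set: 'I_d]) [set w | 0 <= xB A (Ib k) (bn n w) i 0])).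
    apply: countable_bigcupT_measurable => [|k]; first exact: countableP.
    apply: fin_bigcap_measurable => [|i _]; first exact: finite_finset.
    have := measurable_continuous_comp mbn (mulmx_coord_continuous
      (B := selmx R (m0 + m1) (Ib k) *m invmx (AI A (Ib k))) (j := i))
      measurableT (measurable_itv `[0, +oo[).
    rewrite setTI; congr measurable; apply/seteqP.
    by split => w /=; rewrite in_itv /= andbT /xB mulmxA.
  apply/seteqP; split => [w /optP[k wk]|w [k _ wk]]; first by exists k => // i _; exact: wk.
  by apply/optP; exists k => i; exact: wk.
have mBt n : measurable (Bt n).
  have := measurable_continuous_comp (mGn n) (@norm_continuous _ _)
    measurableT (measurable_itv `]-oo, e * r n[).
  by rewrite setTI; congr measurable; apply/seteqP; split => w /=; rewrite in_itv.
have er : (fun n => e * r n) @ \oo --> +oo.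
  apply/cvgryPge => M; have /cvgryPge/(_ (M / e)) := hr.
  by apply: filterS => n; rewrite ler_pdivrMr // mulrC.
have PBs : (fun n => P (~` Bs n)) @ \oo --> 0%E.
  rewrite (_ : (fun n => _) = (fun n => 1 - P (Bs n))%E); last first.
    by apply/funext => n; rewrite probability_setC.
  by rewrite -(@subee _ 1%E) //; apply: cvgeB => //; exact: cvg_cst.
have PBt : (fun n => P (~` Bt n)) @ \oo --> 0%E.
  rewrite (_ : (fun n => _) = (fun n => P [set w | e * r n <= `|Gn n w|])).
    exact: cvg_dist_tight mGn mG hB1 er.
  apply/funext => n; congr (P _); apply/seteqP.
  by split => w /=; [move/negP; rewrite -leNgt | rewrite leNgt => /negP].
have main : cvg_dist P (fun n w => r n *: (xs n w - xb)) P'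
    (fun w => piecewise_limit A K Ib xb (fun KK => alpha KK w) (G w)).
  apply: (@cvg_dist_piecewise _ _ _ _ _ _ _ _ _ _ Z Z'
    (fun KK p => pattern_gap A K Ib xb KK p.2) (fun KK p => otimes A Ib KK p.1 p.2)
    _ _ (fun n => Bs n `&` Bt n)) => //.
  - move=> n; apply: open_measurable_matrix => i j; rewrite (ord1 j).
    rewrite (_ : (fun w => _) = (fun w => r n * (xs n w i 0 - xb i 0))).
      by apply: measurable_funM => //; apply: measurable_funB => //; exact: hxs_meas.
    by apply/funext => w; rewrite !mxE.
  - rewrite (_ : (fun w => _) = (fun w => (fun KK w => otimes A Ib KK (Z' KK w).1 (Z' KK w).2)
      (pattern A K Ib xb (G w)) w)); last by apply/funext => w; exact: YE.
    apply: (@open_measurable_fin_select _ _ _ _ _ (fun KK w => otimes A Ib KK (Z' KK w).1 (Z' KK w).2) mpat) => KK U oU.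
    have /continuousP cu := @otimes_continuous R m0 m1 d A N Ib KK.
    exact: (mZ' KK _ (cu _ oU)).
  - move=> KK p; apply: (@continuous_comp _ _ _ snd (pattern_gap A K Ib xb KK)).
      exact: cvg_snd.
    exact: pattern_gap_continuous.
  - exact: otimes_continuous.
  - move=> KK /=; apply/negligibleP.
      have := measurable_continuous_comp mG (@pattern_gap_continuous _ _ _ _ A N K Ib xb KK)
        measurableT (measurable_set1 (0 : R)).
      by rewrite setTI.
    pose row_of k j := lsubmx (row j (invmx (AI A (Ib k)))) : 'rV[R]_m0.
    pose F n : set T' := if unpickle n is Some (k, j) then
      (if row_of k j != 0 then [set w | (row_of k j *m usubmx (G w)) 0 0 = 0] else set0)
      else set0.
    apply: (@negligibleS _ _ _ _ (\bigcup_n F n)).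
      move=> w /= /(pattern_gap_eq0 (hG0 w))[k [j [kj0 kjG]]].
      by exists (pickle (k, j)) => //; rewrite /F pickleK kj0.
    apply: negligible_bigcup => n; rewrite /F.
    case: unpickle => [[k j]|]; last exact: negligible_set0.
    case: ifPn => [/rV0Pn[i0 i0P]|_]; last exact: negligible_set0.
    have mUG : rand_cV (fun w => usubmx (G w)).
      move=> i; rewrite (_ : (fun w => _) = (fun w => G w (lshift m1 i) 0)) //.
      by apply/funext => w; rewrite mxE.
    apply/negligibleP; last exact: (law_abs_cont_hyperplane hGac mUG i0P).
    have oUG : open_measurable_map (fun w => usubmx (G w)).
      by apply: open_measurable_matrix => i z; rewrite (ord1 z); exact: mUG.
    have := measurable_continuous_comp oUG (mulmx_coord_continuous (B := row_of k j) (j := 0))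
      measurableT (measurable_set1 (0:R)).
    by rewrite setTI.
  - by move=> n; exact: measurableI.
  - apply: (@squeeze_cvge _ _ _ _ (fun=> 0%E) _ (fun n => P (~` Bs n) + P (~` Bt n))%E).
    + near=> n; rewrite measure_ge0 /= setCI.
      by apply: measureU2; exact: measurableC.
    + exact: cvg_cst.
    + by rewrite -[X in _ --> X]adde0; apply: cvgeD.
  - move=> n w [wopt wsmall]; exists (pattern A K Ib xb (Gn n w)).
    have near_b : `|bn n w - b| < e.
      rewrite bnE addrC addKr normrZ normfV (gtr0_norm (hr_pos n)).
      by rewrite mulrC ltr_pdivrMr.
    have patP k : nonneg_vec (xB A (Ib k) (bn n w)) <-> k \in pattern A K Ib xb (Gn n w).
      rewrite bnE; apply: nonneg_patternP => //; first by rewrite invr_gt0.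
      by move=> k' i; rewrite -bnE; exact: stable.
    have S0 : pattern A K Ib xb (Gn n w) != finset.set0.
      by have [k /patP kS] := (optP _).1 wopt; apply/set0Pn; exists k.
    split.
    + rewrite (halphan_rep _ _ _ S0 patP) {1}bnE /Z /an (negbTE S0) /=.
      apply: (otimes_rescale (K := K)) => //; last exact: halphan_simp.
      by move=> k; exact: pattern_lt.
    + exact: pattern_gap_ge0.
    + by move=> KK; exact: pattern_gap_le0.
  - move=> w; exists (pattern A K Ib xb (G w)); split; first exact: YE.
      exact: pattern_gap_ge0.
    by move=> KK; exact: pattern_gap_le0.
split; first exact: main.
move=> nd.
(* In [nondeg_basic_sol] the set whose cardinal is taken is a classical one. *)
have {}nd : #|[set i | xb i 0 != 0]%SET| = (m0 + m1)%N.
  rewrite -nd; apply: eq_card => i; rewrite [LHS]inE.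
  by apply/idP/idP => [?|]; [exact: mem_set | move/set_mem].
(* The support of [xb] is contained in [Ib k], and nondegeneracy gives both the same cardinal. *)
have IbE (k : 'I_N) : (k < K)%N -> Ib k = [set i | xb i 0 != 0]%SET.
  move=> kK; apply/esym/eqP; rewrite eqEcard; apply/andP; split.
    apply/fintype.subsetP => i; rewrite inE; apply: contraNT => iI.
    by rewrite -(xb_basic k kK) xB_out.
  by have [-> _] := basisIb k; rewrite nd.
have K_le1 (k : 'I_N) : (k < K)%N -> val k = 0%N.
  move=> kK; have N0 : (0 < N)%N by apply: leq_ltn_trans (ltn_ord k).
  have k0K : (Ordinal N0 < K)%N by apply: leq_ltn_trans kK.
  by rewrite (hIb_inj k (Ordinal N0)) // !IbE.
have K1 : K = 1%N.
  have [k /hIbK kK] := (optP b).1 (ex_intro _ _ xopt).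
  apply/eqP; rewrite eqn_leq; apply/andP; split; last by apply: leq_ltn_trans kK.
  rewrite leqNgt; apply/negP => K2.
  by have := K_le1 (Ordinal (leq_trans K2 hKN)) K2.
split=> // k1 k10.
rewrite (_ : (fun w => xB A (Ib k1) (G w)) =
  (fun w => piecewise_limit A K Ib xb (fun KK => alpha KK w) (G w))) //.
apply/funext => w; rewrite piecewise_limitE //.
(* Every basic coordinate of [xb] is positive, so the cone of [k1] has no constraint and contains
   every point. *)
have -> : pattern A K Ib xb (G w) = [set k1]%SET.
  apply/setP => k; rewrite finset.in_set1; apply/idP/eqP => [kS|->].
    by apply/val_inj; rewrite k10 K_le1 // (pattern_lt kS).
  have k1K : (k1 < K)%N by rewrite k10 K1.
  rewrite inE; apply/Hcone_gapP => // j; rewrite inE => /existsP[i /and3P[iI _ iP]].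
  move: iP; rewrite inE lt_neqAle xb_ge0 andbT eq_sym negbK => xi.
  by move: iI; rewrite IbE // inE xi.
have [_ [aout a1]] : in_simplex [set k1]%SET (alpha [set k1]%SET w).
  by apply: halpha_simp; apply/set0Pn; exists k1; rewrite inE.
rewrite /otimes big_set1 (_ : alpha _ w 0 k1 = 1) ?scale1r //.
rewrite -a1 (bigD1 k1) //= big1 ?addr0 // => k kk1.
by rewrite aout // inE.
Unshelve. all: by end_near. Qed.
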